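(* Let $N\ge1$ be an integer. (a) A measure $\mu\in M(\mathbb T)$ satisfies $N_*\mu=\mu$ if and only if the following functional equation holds for some constant $c_0$: $$\hat\mu(\eta^N)=\sum_{\zeta^N=1}\hat\mu(\zeta\eta)-c_0\quad\text{for }\lambda\text{-almost all }\eta\in\mathbb T.$$ In this case the equation holds for all $\eta\in\mathbb T$ and we have $c_0=\sum_{\zeta^N=1}\hat\mu(\zeta)=(N-1)\mu_0$. (b) A measure $\mu\in M(\mathbb T)$ is $N$-invariant (i.e. $N_*\mu=\mu$) if and only if for all $z\in D$ we have $$G_\mu(z^N)=\sum_{\zeta^N=1}G_\mu(\zeta z).$$
   Context: $\mathbb T$ is the unit circle, identified with $[0,2\pi)$ via $\theta\mapsto e^{i\theta}$; $D$ is the open unit disc; $\lambda$ is the Haar probability measure on $\mathbb T$. $M(\mathbb T)$ is the space of finite real (signed) Borel measures on $\mathbb T$; $N_*\mu$ is the push-forward under $\zeta\mapsto\zeta^N$. The cumulative mass function $\hat\mu:\mathbb T\to\mathbb R$ is $\hat\mu(e^{i\theta})=\mu(\{e^{it}:0\le t<\theta\})$ for $0\le\theta<2\pi$, and $\mu_0=\int_{\mathbb T}\hat\mu\,d\lambda$. With the Herglotz transform $h_\mu(z)=\int_{\mathbb T}\frac{\zeta+z}{\zeta-z}\,d\mu(\zeta)$ put $G_\mu(z)=\frac1{2\pi i}\int_0^z(h_\mu(w)-\mu(\mathbb T))\frac{dw}w$ for $z\in D$. *)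

(* Defs.v *)
From HB Require Import structures.
From mathcomp Require Import all_boot all_order all_algebra.
From mathcomp Require Import complex.
From mathcomp Require Import all_classical all_reals all_analysis.
From mathcomp Require Import measurable_realfun.
From mathcomp Require Import ring lra.

Set Implicit Arguments.
Unset Strict Implicit.
Unset Printing Implicit Defensive.

Import Order.TTheory GRing.Theory Num.Theory.
Import numFieldNormedType.Exports.

Local Open Scope complex_scope.
Local Open Scope classical_set_scope.
Local Open Scope ring_scope.

Record circle (R : realType) := Circle {
  circle_val :> R[i];
  circle_norm : `|circle_val| == 1 }.

HB.instance Definition _ (R : realType) := [isSub for @circle_val R].
HB.instance Definition _ (R : realType) := [Choice of circle R by <:].

Section circle_group.
Variable R : realType.
Implicit Types x y z : circle R.

Let norm1 : `|1 : R[i]| == 1. Proof. by rewrite normr1. Qed.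
Let normM x y : `|circle_val x * circle_val y| == 1.
Proof. by rewrite normrM (eqP (circle_norm x)) (eqP (circle_norm y)) mulr1. Qed.
Let normV x : `|(circle_val x)^-1| == 1.
Proof. by rewrite normfV (eqP (circle_norm x)) invr1. Qed.

Definition circle_one : circle R := Circle norm1.
Definition circle_mul x y : circle R := Circle (normM x y).
Definition circle_inv x : circle R := Circle (normV x).

Lemma circle_neq0 x : circle_val x != 0.
Proof. by rewrite -normr_eq0 (eqP (circle_norm x)) oner_eq0. Qed.

Let mulA : associative circle_mul.
Proof. by move=> x y z; apply/val_inj; rewrite /= mulrA. Qed.
Let mul1 : left_id circle_one circle_mul.
Proof. by move=> x; apply/val_inj; rewrite /= mul1r. Qed.
Let mulx1 : right_id circle_one circle_mul.
Proof. by move=> x; apply/val_inj; rewrite /= mulr1. Qed.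
Let mulV : left_inverse circle_one circle_inv circle_mul.
Proof. by move=> x; apply/val_inj; rewrite /= mulVf ?circle_neq0. Qed.
Let mulxV : right_inverse circle_one circle_inv circle_mul.
Proof. by move=> x; apply/val_inj; rewrite /= divff ?circle_neq0. Qed.

HB.instance Definition _ :=
  isGroup.Build (circle R) mulA mul1 mulx1 mulV mulxV.

Lemma circle_valM x y : circle_val (x * y)%g = circle_val x * circle_val y.
Proof. by []. Qed.

Lemma circle_valX x n : circle_val (x ^+ n)%g = circle_val x ^+ n.
Proof.
elim: n => [|n IH]; first by rewrite expg0 expr0.
by rewrite expgS circle_valM IH exprS.
Qed.

End circle_group.

(* Subspace topology of C (carried by the alias R[i]^o) and its Borel
   sigma-algebra. *)
HB.instance Definition _ (R : realType) := isPointed.Build (circle R) 1%g.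
HB.instance Definition _ (R : realType) := Topological.copy (circle R)
  (initial_topology (@circle_val R : circle R -> R[i]^o)).
HB.instance Definition _ (R : realType) := Measurable.copy (circle R)
  (g_sigma_algebraType (@open (circle R))).

Section circle_param.
Variable R : realType.
Implicit Types (t : R) (x : circle R).

Let norm_cos_sin t : `|cos t +i* sin t| == 1.
Proof. by rewrite normc_def /= cos2Dsin2 sqrtr1. Qed.

Definition expi t : circle R := Circle (norm_cos_sin t).

Lemma expi0 : expi 0 = 1%g.
Proof. by apply/val_inj; rewrite /= cos0 sin0. Qed.

Lemma expiD s t : expi (s + t) = (expi s * expi t)%g.
Proof.
apply/val_inj => /=; rewrite cosD sinD; apply/eqP.
by rewrite eq_complex /= eqxx addrC eqxx.
Qed.

Lemma expi2pi t : expi (t + 2 * pi) = expi t.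
Proof.
by apply/val_inj; rewrite /= mulr_natl cosD2pi sinD2pi.
Qed.

Lemma expi_surj x : exists2 t, 0 <= t < 2 * pi & expi t = x.
Proof.
case: x => -[a b] /= nx.
have ab : a ^+ 2 + b ^+ 2 = 1.
  move: (nx); rewrite normc_def /= => /eqP [] /(congr1 (fun u => u ^+ 2)).
  by rewrite sqr_sqrtr ?expr1n// addr_ge0 ?sqr_ge0.
have a1 : -1 <= a <= 1.
  by rewrite -ler_norml -(@expr_le1 _ 2)// real_normK ?num_real//
    -ab lerDl sqr_ge0.
have sqE : Num.sqrt (1 - a ^+ 2) = `|b|.
  by rewrite -sqrtr_sqr -ab; congr Num.sqrt; ring.
have p0 := pi_gt0 R.
have [b0|b0] := leP 0 b.
  exists (acos a).
    rewrite acos_ge0//=; have := acos_lepi a1; lra.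
  by apply/val_inj; rewrite /= acosK// sin_acos// sqE ger0_norm.
have a11 : -1 <= a < 1.
  move: a1 => /andP[-> a1] /=; rewrite lt_neqAle a1 andbT; apply/eqP => a_1.
  by move: ab; rewrite a_1; nra.
have agt1 : 0 < acos a by exact: acos_gt0.
exists (2 * pi - acos a).
  have := acos_lepi a1; lra.
apply/val_inj; rewrite /= addrC mulr_natl cosD2pi sinD2pi cosN sinN acosK//.
by rewrite sin_acos// sqE ltr0_norm// opprK.
Qed.

(* The angle of [x] in [0, 2 pi[; see [circle_argP]. *)
Definition circle_arg x : R :=
  xget 0 [set t | 0 <= t < 2 * pi /\ expi t = x].

Lemma circle_argP x : 0 <= circle_arg x < 2 * pi /\ expi (circle_arg x) = x.
Proof.
rewrite /circle_arg; case: xgetP => [t _ //|noarg].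
by have [t t01 tx] := expi_surj x; case: (noarg t).
Qed.

Lemma continuous_expi : continuous expi.
Proof.
apply: continuous_comp_initial => t.
apply/cvgrPdist_lt => -[e f] e0.
have {e0} [f0 e0] : f = 0 /\ 0 < e.
  by move: e0; rewrite ltcE /= => /andP[/eqP-> ->].
rewrite f0; near=> s => /=.
rewrite normc_def ltcR /=.
apply: (@le_lt_trans _ _ (`|cos t - cos s| + `|sin t - sin s|)).
  rewrite -(@ler_pXn2r _ 2)// ?nnegrE ?sqrtr_ge0 ?addr_ge0// sqr_sqrtr ?addr_ge0 ?sqr_ge0//.
  by rewrite [leRHS]sqrrD !real_normK ?num_real// lerD2r lerDl mulrn_wge0 ?mulr_ge0.
rewrite [e]splitr ltrD//.
- near: s; move/cvgrPdist_lt: (@continuous_cos R t); apply.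
  by rewrite divr_gt0.
- near: s; move/cvgrPdist_lt: (@continuous_sin R t); apply.
  by rewrite divr_gt0.
Unshelve. all: by end_near. Qed.

Lemma measurable_expi : measurable_fun [set: R] expi.
Proof.
apply: measurability; first exact: erefl.
move=> _ [U oU <-]; apply: measurableI => //.
by apply: open_measurable; apply: open_comp => // t _; exact: continuous_expi.
Qed.

End circle_param.
Arguments expi {R} t.

HB.instance Definition _ (R : realType) :=
  isMeasurableFun.Build _ _ R (circle R) expi (@measurable_expi R).

Section haar_measure.
Variable R : realType.
Notation leb := (@lebesgue_measure R).

(* Normalized arc length; see [haar_invariant]. *)
Definition haar (A : set (circle R)) : \bar R :=
  (((2 * pi)^-1)%R%:E * leb (expi @^-1` A `&` `[0%R, (2 * pi)%R[))%E.

Let twopi_gt0 : 0 < 2 * pi :> R.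
Proof. by rewrite mulr_gt0// pi_gt0. Qed.

Let twopiV_ge0 : 0 <= (2 * pi)^-1 :> R.
Proof. by rewrite invr_ge0 ltW. Qed.

Let m : {measure set (circle R) -> \bar R} :=
  mscale (NngNum twopiV_ge0)
    (measure_function_pushforward__canonical__measure_function_Measure
      (mrestr leb (measurable_itv `[0, 2 * pi[)) (@measurable_expi R)).

Let haar0 : haar set0 = 0%E. Proof. exact: (measure0 m). Qed.
Let haar_ge0 A : (0 <= haar A)%E. Proof. exact: (measure_ge0 m). Qed.
Let haar_sigma_additive : semi_sigma_additive haar.
Proof. exact: (@measure_semi_sigma_additive _ _ _ m). Qed.

HB.instance Definition _ := isMeasure.Build _ _ _
  haar haar0 haar_ge0 haar_sigma_additive.

Let haarT : haar setT = 1%E.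
Proof.
rewrite /haar preimage_setT setTI lebesgue_measure_itv/= lte_fin twopi_gt0.
by rewrite -EFinB subr0 -EFinM mulVf// gt_eqF.
Qed.

HB.instance Definition _ := @Measure_isProbability.Build _ _ _ haar haarT.

Lemma lebesgue_measure_translation (s : R) (A : set R) : measurable A ->
  leb ((fun t => s + t) @^-1` A) = leb A.
Proof.
have ms : measurable_fun [set: measurableTypeR R]
    ((fun t => s + t) : _ -> measurableTypeR R).
  apply: continuous_measurable_fun => t.
  by apply: cvgD; [exact: cvg_cst|exact: cvg_id].
pose nu := measure_function_pushforward__canonical__measure_function_Measure
  leb ms.
move=> mA; apply/esym; apply: (@lebesgue_measure_unique _ nu) => //.
move=> _ [[a b] _ <-]; rewrite /nu /= /pushforward.
have -> : (fun t : R => s + t) @^-1` `]a, b] = `]a - s, b - s]%classic.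
  by apply/seteqP; split=> t /=; rewrite !in_itv/=; lra.
rewrite !lebesgue_measure_itv/= !lte_fin ltrD2r; case: ifPn => // _.
by rewrite -!EFinB; congr EFin; ring.
Qed.

Lemma haar_invariant (x : circle R) (A : set (circle R)) : measurable A ->
  haar ((fun y => x * y)%g @^-1` A) = haar A.
Proof.
move=> mA; pose B := expi @^-1` A.
have mB : measurable B.
  by rewrite -[X in measurable X]setTI; exact: measurable_expi.
have [s /andP[s0 s2] sx] := expi_surj x.
have BD t : B (2 * pi + t) = B t by rewrite /B /= addrC expi2pi.
rewrite /haar; congr (_ * _)%E.
transitivity (leb (B `&` `[s, s + 2 * pi[)).
  rewrite -[RHS](lebesgue_measure_translation s); last exact: measurableI.
  congr (leb _); apply/seteqP; split => t /=;
    rewrite !in_itv /= /B /= expiD sx => -[? ?]; split => //; lra.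
have mI a b : measurable (B `&` `[a, b[) by exact: measurableI.
have split3 a b c : a <= b -> b <= c ->
    leb (B `&` `[a, c[) = (leb (B `&` `[a, b[) + leb (B `&` `[b, c[))%E.
  move=> ab bc.
  have dis : (B `&` `[a, b[) `&` (B `&` `[b, c[) = set0.
    by apply/seteqP; split => t //= [[_ +] [_]]; rewrite !in_itv/=; lra.
  rewrite -(measureU leb _ _ dis)//; [|exact: mI..].
  congr (leb _); rewrite -setIUr; congr (_ `&` _); apply/seteqP.
  split => t /=; rewrite !in_itv/=; last by case; lra.
  by move=> tac; case: (ltP t b) => tb; [left|right]; lra.
rewrite (split3 _ (2 * pi))//; [|exact: ltW|lra].
rewrite [RHS](split3 _ s)//; [|exact: ltW].
rewrite addeC; congr (_ + _)%E.
rewrite -(lebesgue_measure_translation (2 * pi))//.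
congr (leb _); apply/seteqP.
by split => t /=; rewrite !in_itv/= BD => -[? ?]; split => //; lra.
Qed.

End haar_measure.
Arguments haar {R} A.

Section complex_integral.
Context d (T : measurableType d) (R : realType).

Definition cintegral (mu : {measure set T -> \bar R}) (D : set T)
    (f : T -> R[i]) : R[i] :=
  (\int[mu]_(x in D) complex.Re (f x)) +i* (\int[mu]_(x in D) complex.Im (f x)).

Variable nu : {charge set T -> \bar R}.

Let hahn_ex := cid (Hahn_decomposition nu).
Definition hahn_pos : set T := sval hahn_ex.
Definition hahn_neg : set T := sval (cid (svalP hahn_ex)).
Lemma hahn_posneg : hahn_decomposition nu hahn_pos hahn_neg.
Proof. exact: svalP (cid (svalP hahn_ex)). Qed.

(* The integral of f against the signed measure nu = nu^+ - nu^-. *)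
Definition charge_cintegral (f : T -> R[i]) : R[i] :=
  cintegral (jordan_pos hahn_posneg) setT f -
  cintegral (jordan_neg hahn_posneg) setT f.

End complex_integral.

(* The integral of f(w) dw along the segment from a to b, w = a + t (b - a). *)
Definition segment_integral (R : realType) (f : R[i] -> R[i]) (a b : R[i]) :
    R[i] :=
  cintegral (@lebesgue_measure R) `[0, 1]
    (fun t => f (a + t%:C * (b - a)) * (b - a)).

Section circle_charge.
Variables (R : realType) (mu : {charge set (circle R) -> \bar R}).

(* N_* mu = mu as measures: a charge is a total function on sets, so the
   equality is only required on Borel sets. *)
Definition power_invariant (N : nat) : Prop :=
  forall A : set (circle R), measurable A ->
    pushforward mu (fun z : circle R => (z ^+ N)%g) A = mu A.

(* The cumulative mass function: the mass of {e^{it} : 0 <= t < theta} for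
   x = e^{i theta} with 0 <= theta < 2 pi. *)
Definition cmf (x : circle R) : R :=
  fine (mu (expi @` `[0, circle_arg x[)).

Definition cmf_mean : R := \int[haar]_x cmf x.

Definition herglotz (z : R[i]) : R[i] :=
  charge_cintegral mu (fun zeta : circle R =>
    (circle_val zeta + z) / (circle_val zeta - z)).

(* The integrand extends holomorphically across 0 in D, so the integral from 0
   to z does not depend on the path; the segment is used. *)
Definition herglotz_primitive (z : R[i]) : R[i] :=
  (0 +i* (2 * pi))^-1 *
  segment_integral (fun w => (herglotz w - (fine (mu setT))%:C) / w) 0 z.

End circle_charge.

(* Main.v *)
Require Import Defs.
From HB Require Import structures.
From mathcomp Require Import all_boot all_order all_algebra.
From mathcomp Require Import complex.
From mathcomp Require Import all_classical all_reals all_analysis.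
From mathcomp Require Import measurable_realfun.
From mathcomp Require Import ring lra.

Import Order.TTheory GRing.Theory Num.Theory.
Import numFieldNormedType.Exports.

Local Open Scope complex_scope.
Local Open Scope classical_set_scope.
Local Open Scope ring_scope.

Set Implicit Arguments.
Unset Strict Implicit.
Unset Printing Implicit Defensive.

(* Write mu = p - n (Jordan).  Then N_* mu = mu says that the finite positive
   measures N_* p + n and p + N_* n coincide.

   (a) Grouping the N-th roots of eta^N gives, for every mu and every eta,
     sum_{zeta^N = 1} cmf mu (zeta eta)
       = (N_* mu)(arc from 1 to eta^N) + sum_{zeta^N = 1} cmf mu zeta,
   so the functional equation compares N_* mu and mu on the arcs from 1, up to
   a constant.  Left continuity extends an almost everywhere equality to all
   arcs of length in (0, 2 pi], and the full circle shows that the constant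
   vanishes.  The value of c_0 comes from integrating against Haar measure.

   (b) With c_j = int zeta^{-j} d mu, a geometric expansion of the kernel with
   explicit remainder gives G_mu(z) = (1 / (pi i)) sum_{j >= 1} c_j z^j / j on
   the disc; summing over the roots of unity keeps the multiples of N, so the
   equation says c_{Nj} = c_j for j >= 1.  These are the equalities of the
   Fourier coefficients of N_* p + n and p + N_* n.  Finite measures with the
   same Fourier coefficients are equal: they agree on trigonometric polynomials,
   hence, through the polynomials (1 - u^k)^(k 2^k) -> 1_{u < 1/2}, on open
   arcs. *)

(** * Arcs of the circle *)

Section circle_arcs.
Variable R : realType.
Implicit Types (s t : R) (x y a : circle R).

Lemma pi2_gt0 : 0 < 2 * pi :> R.
Proof. by rewrite mulr_gt0// pi_gt0. Qed.

Lemma circle_arg_ge0 x : 0 <= circle_arg x.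
Proof. by have [/andP[]] := circle_argP x. Qed.

Lemma circle_arg_lt2pi x : circle_arg x < 2 * pi.
Proof. by have [/andP[]] := circle_argP x. Qed.

Lemma circle_argK : cancel (@circle_arg R) expi.
Proof. by move=> x; have [] := circle_argP x. Qed.

(** The half-angle formula [cos t = 1 - 2 sin^2 (t / 2)] decides, since [sin (t / 2) > 0] for
    [0 < t < 2 pi]. *)
Lemma expi_eq1 t : 0 <= t < 2 * pi -> expi t = 1%g -> t = 0.
Proof.
move=> /andP[t0 t2] /(congr1 (@circle_val R)) /= [ct _].
apply/eqP; rewrite eq_le t0 andbT leNgt; apply/negP => t_gt0.
have s0 : 0 < sin (t / 2) by apply: sin_gt0_pi; rewrite //=; lra.
have : cos t = 1 - sin (t / 2) ^+ 2 *+ 2.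
  have {1}-> : t = (t / 2) *+ 2 by rewrite mulr2n -splitr.
  by rewrite cos_mulr2n cos2sin2 !mulr2n; lra.
by rewrite ct; have := exprn_gt0 2 s0; lra.
Qed.

Lemma expiB s t : expi (s - t) = (expi s * (expi t)^-1)%g.
Proof. by apply: (@mulIg _ (expi t)); rewrite -mulgA mulVg mulg1 -expiD subrK. Qed.

Lemma expiK t : 0 <= t < 2 * pi -> circle_arg (expi t) = t.
Proof.
move=> t02; have [+ e] := circle_argP (expi t).
move: (circle_arg _) e => s e s02.
case: (leP t s) => st; apply/eqP; rewrite -subr_eq0; apply/eqP.
  apply: expi_eq1; first lra.
  by rewrite expiB e mulgV.
apply/oppr_inj; rewrite oppr0 opprB; apply: expi_eq1; first lra.
by rewrite expiB e mulgV.
Qed.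

Lemma circle_arg1 : circle_arg (1%g : circle R) = 0.
Proof. by rewrite -expi0 expiK// lexx pi2_gt0. Qed.

Lemma normc_ReIm (z : R[i]) : `|complex.Re z| <= complex.Re `|z|
  /\ `|complex.Im z| <= complex.Re `|z|.
Proof.
case: z => u v; rewrite normc_def /=; split.
  by rewrite -(sqrtr_sqr u) ler_wsqrtr// lerDl sqr_ge0.
by rewrite -(sqrtr_sqr v) ler_wsqrtr// lerDr sqr_ge0.
Qed.

Lemma continuous_ReIm :
  continuous (@complex.Re R : R[i]^o -> R) /\
  continuous (@complex.Im R : R[i]^o -> R).
Proof.
have key (f : R[i]^o -> R) : (forall z w, `|f z - f w| <= complex.Re `|z - w|) ->
    continuous f.
  move=> fl z; apply/(@cvgrPdist_lt _ R _ (nbhs z) (nbhs_filter z)) => e e0.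
  near=> w; apply: le_lt_trans (fl z w) _.
  have : `|z - w| < e%:C.
    near: w; apply: (@cvgr_dist_lt _ _ _ (nbhs z) (nbhs_filter z) id) => //.
    by rewrite ltcR.
  by rewrite ltcE => /andP[].
split; apply: key => z w; rewrite -raddfB.
  exact: (normc_ReIm _).1.
exact: (normc_ReIm _).2.
Unshelve. all: by end_near. Qed.

Lemma continuous_circle_val : continuous (@circle_val R : circle R -> R[i]^o).
Proof. exact: initial_continuous. Qed.

Lemma continuous_circle_measurable (f : circle R -> R) :
  continuous f -> measurable_fun [set: circle R] f.
Proof.
move=> cf; apply: (measurability (@RGenOpens.G R)) => [|_ [_ [a [b ->]] <-]].
  exact: RGenOpens.measurableE.
rewrite setTI; apply: sub_sigma_algebra.
by apply: open_comp; [move=> x _; exact: cf|exact: interval_open].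
Qed.

Lemma measurable_circle_Re :
  measurable_fun [set: circle R] (fun x => complex.Re (circle_val x)).
Proof.
apply: continuous_circle_measurable => x.
exact: (continuous_comp (@continuous_circle_val x) (continuous_ReIm.1 _)).
Qed.

Lemma measurable_circle_Im :
  measurable_fun [set: circle R] (fun x => complex.Im (circle_val x)).
Proof.
apply: continuous_circle_measurable => x.
exact: (continuous_comp (@continuous_circle_val x) (continuous_ReIm.2 _)).
Qed.

(** The half-open arc from 1 of length [s]. Writing it through [circle_arg] lets [s] be any real:
    the arc is empty for [s <= 0] and the whole circle for [s >= 2 pi]. *)
Definition circle_arc s : set (circle R) := [set x | circle_arg x < s].

(** The trace of an open half-plane: when [-1 < s < 1], an open arc centred at [expi t]. Being cut
    out by an inequality on a trigonometric polynomial, it is accessible to Fourier coefficients. *)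
Definition circle_cap t s : set (circle R) :=
  [set x | cos t * complex.Re (circle_val x)
           + sin t * complex.Im (circle_val x) > s].

Lemma circle_capE t s x : circle_cap t s x <-> s < cos (circle_arg x - t).
Proof.
by rewrite /circle_cap /= -{1 2}(circle_argK x) /= cosB mulrC (mulrC (sin t)).
Qed.

Lemma measurable_cap t s : measurable (circle_cap t s).
Proof.
pose f x := cos t * complex.Re (circle_val x)
           + sin t * complex.Im (circle_val x).
have mf : measurable_fun [set: circle R] f.
  apply: measurable_funD; apply: measurable_funM => //.
    exact: measurable_circle_Re.
  exact: measurable_circle_Im.
rewrite (_ : circle_cap t s = f @^-1` `]s, +oo[); last first.
  by apply/seteqP; split => x /=; rewrite in_itv/= andbT.
by rewrite -[X in measurable X]setTI; exact: mf.
Qed.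

(** The cap centred at -1 with bound -1 is [Re x < 1], that is, the circle without 1. *)
Lemma set1_capE : [set 1%g] = ~` circle_cap pi (- 1).
Proof.
apply/seteqP; split=> x /=; rewrite circle_capE.
  by move=> ->; rewrite circle_arg1 sub0r cosN cospi ltxx.
rewrite cosB cospi sinpi mulr0 addr0 mulrN1 ltrN2 => /negP.
rewrite -leNgt => c1; rewrite -(circle_argK x) -expi0; congr expi.
apply: expi_eq1; first by rewrite circle_arg_ge0 circle_arg_lt2pi.
have {}c1 : cos (circle_arg x) = 1 by apply/eqP; rewrite eq_le c1 cos_le1.
apply/val_inj; rewrite /= c1.
have := cos2Dsin2 (circle_arg x).
rewrite c1 expr1n => /eqP; rewrite -subr_eq0 addrAC subrr add0r sqrf_eq0.
by move=> /eqP ->.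
Qed.

(** Without its endpoint 1, the arc is open with midpoint of angle [s / 2], hence a cap; the cosine
    decreases with the distance to the midpoint. *)
Lemma cap_arcE s : 0 < s < 2 * pi ->
  circle_arc s = [set 1%g] `|` circle_cap (s / 2) (cos (s / 2)).
Proof.
move=> /andP[s0 s2]; have p0 := pi_gt0 R.
have cosw (u v : R) : 0 <= u <= pi -> 0 <= v <= pi -> (cos u < cos v) = (v < u).
  by move=> u1 v1; rewrite ltr_cos// in_itv.
apply/seteqP; split=> x /=; rewrite circle_capE.
  rewrite /circle_arc /= => xs.
  have [x0|x0] := eqVneq (circle_arg x) 0.
    by left; rewrite -(circle_argK x) x0 expi0.
  have {}x0 : 0 < circle_arg x by rewrite lt_neqAle eq_sym x0 circle_arg_ge0.
  right; have [h|h] := leP (s / 2) (circle_arg x); first by rewrite cosw//; lra.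
  by rewrite -[ltRHS]cosN cosw//; lra.
have x0 := circle_arg_ge0 x; have x2 := circle_arg_lt2pi x.
rewrite /circle_arc /=.
case=> [->|]; first by rewrite circle_arg1.
have [h1|h1] := leP (circle_arg x - s / 2) 0; first by move=> _; lra.
have [h2|h2] := leP (circle_arg x - s / 2) pi; first by rewrite cosw//; lra.
(* Beyond the antipode of the midpoint the angle leaves the interval where [cos] decreases. It is
   replaced by its complement to [2 pi], and membership in the cap then contradicts
   [circle_arg x < 2 pi]. *)
have -> : cos (circle_arg x - s / 2) = cos (2 * pi - (circle_arg x - s / 2)).
  by rewrite mulr_natl [X in _ = cos X]addrC cosD2pi cosN.
by rewrite cosw; lra.
Qed.

Lemma arc_le0 s : s <= 0 -> circle_arc s = set0.
Proof.
move=> s0; apply/seteqP; split=> // x /= xs.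
by have := lt_le_trans xs s0; rewrite ltNge circle_arg_ge0.
Qed.

Lemma arc_ge2pi s : 2 * pi <= s -> circle_arc s = setT.
Proof.
move=> s2; apply/seteqP; split=> // x _; exact: lt_le_trans (circle_arg_lt2pi x) s2.
Qed.

Lemma measurable_set1_circle : measurable [set 1%g : circle R].
Proof. by rewrite set1_capE; apply: measurableC; exact: measurable_cap. Qed.

Lemma measurable_arc s : measurable (circle_arc s).
Proof.
have [s0|s0] := leP s 0; first by rewrite arc_le0.
have [s2|s2] := leP (2 * pi) s; first by rewrite arc_ge2pi.
rewrite cap_arcE ?s0//; apply: measurableU; last exact: measurable_cap.
exact: measurable_set1_circle.
Qed.

Lemma expi_arcE s : s <= 2 * pi -> expi @` `[0, s[ = circle_arc s.
Proof.
move=> s2; apply/seteqP; split=> [_ [t + <-]|x xs] /=.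
  rewrite /= in_itv/= /circle_arc/= => /andP[t0 ts].
  by rewrite expiK// t0 (lt_le_trans ts).
by exists (circle_arg x); [rewrite /= in_itv/= circle_arg_ge0|exact: circle_argK].
Qed.

(** The angle jumps at 1, so continuity does not apply; its strict sublevel sets are the arcs. *)
Lemma measurable_circle_arg : measurable_fun [set: circle R] (@circle_arg R).
Proof.
apply: (measurability (@RGenInftyO.G R)) => [|_ [_ [s ->] <-]].
  exact: RGenInftyO.measurableE.
rewrite setTI; rewrite (_ : _ @^-1` _ = circle_arc s); first exact: measurable_arc.
by apply/seteqP; split=> x /=; rewrite in_itv.
Qed.

(** Transported to the line by [circle_arg], arcs become half-lines, a generating class stable under
    intersection. The measures are recovered because [expi] is a left inverse of [circle_arg]. *)
Lemma measure_arc_unique (m1 m2 : {measure set (circle R) -> \bar R}) :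
  (m1 setT < +oo)%E -> (forall s, m1 (circle_arc s) = m2 (circle_arc s)) ->
  forall A, measurable A -> m1 A = m2 A.
Proof.
move=> m1T m12 A mA.
pose n1 := measure_function_pushforward__canonical__measure_function_Measure
  m1 measurable_circle_arg.
pose n2 := measure_function_pushforward__canonical__measure_function_Measure
  m2 measurable_circle_arg.
have arcE s : circle_arg (R:=R) @^-1` `]-oo, s[ = circle_arc s.
  by apply/seteqP; split=> x /=; rewrite in_itv.
suff n12 B : measurable B -> n1 B = n2 B.
  have mB : measurable (expi @^-1` A).
    by rewrite -[X in measurable X]setTI; exact: measurable_expi.
  have := n12 _ mB; rewrite /n1 /n2 /= /pushforward -comp_preimage.
  by rewrite (_ : expi \o circle_arg (R:=R) = id)//; apply/funext; exact: circle_argK.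
apply: (@measure_unique _ _ _ (RGenInftyO.G (R:=R))
  (fun k => `]-oo, k%:R[%classic)) => //.
- exact: RGenInftyO.measurableE.
- move=> _ _ [s ->] [t ->]; exists (Num.min s t).
  by apply/seteqP; split=> x /=; rewrite !in_itv/= lt_min => /andP.
- by move=> k; exists k%:R.
- rewrite -subTset => x _; exists (Num.trunc `|x|).+1 => //=.
  by rewrite in_itv/= (le_lt_trans (ler_norm x))// truncnS_gt.
- by move=> _ [s ->]; rewrite /n1 /n2 /= /pushforward arcE m12.
- move=> k; rewrite /n1 /= /pushforward arcE (le_lt_trans _ m1T)//.
  by rewrite le_measure ?inE//; exact: measurable_arc.
Qed.

End circle_arcs.

(** * The power map *)

Section power_map.
Variables (R : realType) (N : nat) (N_ge1 : (1 <= N)%N).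
Implicit Types (s t : R) (x y eta zeta : circle R).

Lemma expiMn n t : expi (n%:R * t) = (expi t ^+ n)%g.
Proof.
elim: n => [|n IH]; first by rewrite mul0r expi0.
by rewrite -natr1 mulrDl mul1r expiD IH expgSr.
Qed.

Lemma expi_periodic n t : expi (t + 2 * pi * n%:R) = expi t.
Proof.
elim: n => [|n IH]; first by rewrite mulr0 addr0.
by rewrite -(natr1 n) mulrDr mulr1 addrA expi2pi.
Qed.

Definition circle_pow x := (x ^+ N)%g.

Lemma circle_powE x : circle_pow x = expi (N%:R * circle_arg x).
Proof. by rewrite expiMn circle_argK. Qed.

Lemma measurable_circle_pow : measurable_fun [set: circle R] circle_pow.
Proof.
rewrite (_ : circle_pow = expi \o (fun x => N%:R * circle_arg x)); last first.
  by apply/funext => x; rewrite circle_powE.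
apply: measurableT_comp; first exact: measurable_expi.
by apply: measurable_funM => //; exact: measurable_circle_arg.
Qed.

Lemma natN_gt0 : 0 < N%:R :> R.
Proof. by rewrite ltr0n. Qed.

Lemma circle_arg_pow (k : nat) x : 2 * pi * k%:R <= N%:R * circle_arg x ->
  N%:R * circle_arg x < 2 * pi * k.+1%:R ->
  circle_arg (circle_pow x) = N%:R * circle_arg x - 2 * pi * k%:R.
Proof.
move=> h1 h2; rewrite circle_powE -[N%:R * _](subrK (2 * pi * k%:R)).
rewrite expi_periodic expiK ?subrK// subr_ge0 h1/=.
by move: h2; rewrite -(natr1 k); lra.
Qed.

(** The circle is cut into [N] sectors of angle [2 pi / N]; [k] is the sector of [x], and also the
    number of full turns made by [N] times its angle. *)
Lemma circle_root_index x : exists2 k : nat, (k < N)%N &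
  2 * pi * k%:R <= N%:R * circle_arg x < 2 * pi * k.+1%:R.
Proof.
have p0 := pi2_gt0 R.
have h0 : 0 <= N%:R * circle_arg x / (2 * pi).
  by rewrite !mulr_ge0 ?circle_arg_ge0// invr_ge0 ltW.
have /andP[h1 h2] := truncn_itv h0.
exists (Num.trunc (N%:R * circle_arg x / (2 * pi))).
  rewrite -(ltr_nat R); apply: le_lt_trans h1 _.
  by rewrite ltr_pdivrMr// ltr_pM2l ?natN_gt0// circle_arg_lt2pi.
by rewrite [2 * pi * _]mulrC -ler_pdivlMr// h1 [2 * pi * _]mulrC -ltr_pdivrMr.
Qed.

Definition circle_root (k : nat) : circle R := expi (2 * pi * k%:R / N%:R).

Lemma root_angle_itv k : (k < N)%N -> 0 <= (2 * pi * k%:R / N%:R : R) < 2 * pi.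
Proof.
move=> kN; have p0 := pi2_gt0 R; rewrite divr_ge0 ?mulr_ge0 ?pi_ge0//=.
by rewrite ltr_pdivrMr ?natN_gt0// ltr_pM2l// ltr_nat.
Qed.

Lemma circle_root_bij : set_bij `I_N [set zeta | (zeta ^+ N)%g = 1%g] circle_root.
Proof.
have N0 := natN_gt0; have p0 := pi2_gt0 R.
split.
- move=> k /= _; rewrite /circle_root -expiMn mulrC divfK ?gt_eqF//.
  by rewrite -[X in expi X]add0r expi_periodic expi0.
- move=> j k /[!inE]/= jN kN /(congr1 (@circle_arg R)).
  rewrite /circle_root !expiK ?root_angle_itv// => h.
  have Ni0 : N%:R^-1 != 0 :> R by rewrite invr_eq0 gt_eqF.
  apply/eqP; rewrite -(eqr_nat R); apply/eqP.
  by apply: (mulfI (lt0r_neq0 p0)); exact: (mulIf Ni0).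
(* In sector [k], the angle of [x ^+ N] is [N] times that of [x] minus [2 pi k]. As it is 0, [x] is
   the left end of its sector. *)
- move=> x /= x1; have [k kN /andP[h1 h2]] := circle_root_index x.
  exists k => //; have := circle_arg_pow h1 h2.
  rewrite /circle_pow x1 circle_arg1 => /esym/eqP; rewrite subr_eq0 => /eqP e.
  by rewrite /circle_root -e mulrAC divff ?gt_eqF// mul1r circle_argK.
Qed.

Lemma sum_roots_ord (V : nmodType) (f : circle R -> V) :
  \sum_(zeta \in [set zeta | (zeta ^+ N)%g = 1%g]) f zeta
  = \sum_(k < N) f (circle_root k).
Proof.
rewrite [RHS](fsbig_ord _ _ (fun k => f (circle_root k))).
by apply: reindex_fsbig; exact: circle_root_bij.
Qed.

(** The quotient of two points with the same [N]-th power is a root of unity, and multiplication by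
    it permutes the roots. *)
Lemma sum_roots_translate (V : nmodType) (f : circle R -> V) x y :
  circle_pow x = circle_pow y ->
  \sum_(zeta \in [set zeta | (zeta ^+ N)%g = 1%g]) f (zeta * x)%g
  = \sum_(zeta \in [set zeta | (zeta ^+ N)%g = 1%g]) f (zeta * y)%g.
Proof.
have pM (u v : circle R) : ((u * v) ^+ N)%g = ((u ^+ N) * (v ^+ N))%g :> circle R.
  by apply: (@val_inj _ _ (circle R)); rewrite /= !circle_valX exprMn.
move=> xy; pose h (z : circle R) := (z * (y * x^-1))%g.
rewrite (reindex_fsbig h [set zeta | (zeta ^+ N)%g = 1%g]).
  by apply: eq_fsbigr => z _; rewrite /h -!mulgA mulVg mulg1.
have xy1 : ((y * x^-1) ^+ N)%g = 1%g :> circle R.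
  by rewrite pM expVgn -/(circle_pow y) -xy mulgV.
split.
- by move=> z /= z1; rewrite /h pM z1 xy1 mulg1.
- by move=> u v _ _; exact: mulIg.
- move=> z /= z1; exists (z * (y * x^-1)^-1)%g.
    by rewrite /= pM z1 expVgn xy1 invg1 mulg1.
  by rewrite /h -mulgA mulVg mulg1.
Qed.

(** Taken over bare set functions, so that charges and measures share it. *)
Definition arc_mass (m : set (circle R) -> \bar R) s := fine (m (circle_arc s)).

Variable mu : {charge set (circle R) -> \bar R}.

Lemma cmfE x : cmf mu x = arc_mass mu (circle_arg x).
Proof. by rewrite /cmf expi_arcE// ltW// circle_arg_lt2pi. Qed.

Lemma measurable_pow_arc s : measurable (circle_pow @^-1` circle_arc s).
Proof.
by rewrite -[X in measurable X]setTI; apply: measurable_circle_pow => //;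
  exact: measurable_arc.
Qed.

(** The preimage of an arc of length [s] under the power map is a disjoint union of [N] arcs of
    length [s / N], one at the start of each sector. *)
Lemma pow_arc_mass s : 0 <= s <= 2 * pi ->
  fine (mu (circle_pow @^-1` circle_arc s)) =
  \sum_(k < N) (arc_mass mu ((2 * pi * k%:R + s) / N%:R)
              - arc_mass mu (2 * pi * k%:R / N%:R)).
Proof.
move=> /andP[s0 s2]; have N0 := natN_gt0; have p0 := pi2_gt0 R.
(* [B k] is the part of the preimage in the first [k] sectors; the induction adds one sector at a
   time. *)
pose B (k : nat) := circle_pow @^-1` circle_arc s `&` circle_arc (2 * pi * k%:R / N%:R).
have mB k : measurable (B k).
  by apply: measurableI; [exact: measurable_pow_arc|exact: measurable_arc].
suff key k : (k <= N)%N -> fine (mu (B k)) =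
    \sum_(i < k) (arc_mass mu ((2 * pi * i%:R + s) / N%:R)
              - arc_mass mu (2 * pi * i%:R / N%:R)).
  rewrite -key// /B mulfK ?gt_eqF// [circle_arc (2 * pi)]arc_ge2pi//.
  by rewrite setIT.
elim: k => [_|k IH kN].
  by rewrite big_ord0 /B mulr0 mul0r [circle_arc 0]arc_le0// setI0 charge0.
rewrite big_ord_recr/= -IH ?(ltnW kN)//.
set a := 2 * pi * k%:R / N%:R; set b := (_ + s) / _.
have ab : a <= b by rewrite ler_pM2r ?invr_gt0// lerDl.
have -> : B k.+1 = B k `|` (circle_arc b `\` circle_arc a).
  apply/seteqP; split => x;
    rewrite /B /circle_arc/= /a /b !ltr_pdivlMr// ![_ * N%:R]mulrC.
    move=> [xs xk]; have [xa|xa] := ltP (N%:R * circle_arg x) (2 * pi * k%:R).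
      by left.
    right; move: xs; rewrite (circle_arg_pow xa xk) ltrBlDl => xs; split => //.
  case=> [[xs xk]|[xb /negP]].
    split=> //; apply: lt_trans xk _; rewrite ltr_pM2l// ltr_nat//.
  rewrite -leNgt => xa.
  have xk : N%:R * circle_arg x < 2 * pi * k.+1%:R.
    by apply: lt_le_trans xb _; rewrite -(natr1 k) [2 * pi * (_ + _)]mulrDr mulr1 lerD2l.
  by rewrite (circle_arg_pow xa xk) ltrBlDl.
have mab : measurable (circle_arc b `\` circle_arc a).
  by apply: measurableD; exact: measurable_arc.
rewrite chargeU//; last first.
  by apply/seteqP; split => // x [[_ +] [_]].
rewrite fineD ?fin_num_measure//; congr (_ + _).
rewrite chargeD; [|exact: measurable_arc..].
rewrite setIidr; last by move=> x; rewrite /circle_arc/= => /lt_le_trans; apply.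
by rewrite fineB// fin_num_measure//; exact: measurable_arc.
Qed.

(* Both sides depend on [eta] only through [eta ^+ N], so [eta] may be taken to
   be [expi (t / N)]. *)
Lemma sum_cmf_roots eta :
  \sum_(zeta \in [set zeta | (zeta ^+ N)%g = 1%g]) cmf mu (zeta * eta)%g =
  fine (mu (circle_pow @^-1` circle_arc (circle_arg (circle_pow eta))))
  + \sum_(zeta \in [set zeta | (zeta ^+ N)%g = 1%g]) cmf mu zeta.
Proof.
have N0 := natN_gt0; have p0 := pi2_gt0 R.
set t := circle_arg (circle_pow eta).
have t0 : 0 <= t by exact: circle_arg_ge0.
have t2 : t < 2 * pi by exact: circle_arg_lt2pi.
have e : circle_pow eta = circle_pow (expi (t / N%:R)).
  by rewrite /circle_pow -expiMn mulrC divfK ?gt_eqF// circle_argK.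
rewrite (sum_roots_translate _ e) !sum_roots_ord pow_arc_mass ?t0 ?ltW//.
rewrite -big_split/=; apply: eq_bigr => k _.
have kN : (k < N)%N by [].
rewrite !cmfE /circle_root -expiD -mulrDl (expiK (root_angle_itv kN)) expiK ?subrK//.
rewrite divr_ge0 ?addr_ge0 ?mulr_ge0 ?pi_ge0//=.
rewrite ltr_pdivrMr//.
have : k.+1%:R <= N%:R :> R by rewrite ler_nat.
by rewrite -(natr1 k) -(ler_pM2l p0); lra.
Qed.

End power_map.

(** * Arc masses of a finite measure *)

Section finite_measure_arcs.
Variables (R : realType) (m : {measure set (circle R) -> \bar R}).
Variable mT : (m setT < +oo)%E.

Lemma finite_measure_fin_num (A : set (circle R)) :
  measurable A -> m A \is a fin_num.
Proof.
move=> mA; rewrite ge0_fin_numE// (le_lt_trans _ mT)//.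
by apply: le_measure; rewrite ?inE.
Qed.

Lemma arc_massK (s : R) : (arc_mass m s)%:E = m (circle_arc s).
Proof. by rewrite /arc_mass fineK// finite_measure_fin_num//; exact: measurable_arc. Qed.

Lemma arc_mass_ge0 (s : R) : 0 <= arc_mass m s.
Proof. by rewrite fine_ge0. Qed.

Lemma arc_mass_nondecreasing : {homo arc_mass m : s t / s <= t}.
Proof.
move=> s t st; rewrite -lee_fin !arc_massK le_measure ?inE//.
- exact: measurable_arc.
- exact: measurable_arc.
- by move=> x; rewrite /circle_arc/= => /lt_le_trans; apply.
Qed.

(** The strict inequality in [circle_arc] makes the arc of length [t] the increasing union of those
    of length [t - 1 / (n + 1)]. Continuity from below gives one good length, and monotonicity
    covers all those between it and [t]. *)
Lemma arc_mass_left_continuous (t e : R) : 0 < e ->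
  exists2 d, 0 < d & forall s, t - d < s <= t -> `|arc_mass m t - arc_mass m s| < e.
Proof.
move=> e0.
pose F n := circle_arc (t - n.+1%:R^-1).
have UF : \bigcup_n F n = circle_arc t.
  apply/seteqP; split=> x; rewrite /F /circle_arc/=.
    by case=> n _ /lt_trans; apply; rewrite ltrBlDr ltrDl invr_gt0 ltr0n.
  move=> xt; have xt0 : 0 < t - circle_arg x by rewrite subr_gt0.
  exists (Num.trunc (t - circle_arg x)^-1) => //=.
  rewrite ltrBrDr -ltrBrDl -[ltRHS]invrK ltf_pV2 ?posrE ?invr_gt0 ?ltr0n//.
  exact: truncnS_gt.
have : m \o F @ \oo --> m (\bigcup_n F n).
  apply: nondecreasing_cvg_mu.
  - by move=> n; exact: measurable_arc.
  - by rewrite UF; exact: measurable_arc.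
  - move=> i j ij; apply/subsetPset => x; rewrite /F /circle_arc/= => /lt_le_trans; apply.
    by rewrite lerD2l lerN2 lef_pV2 ?posrE ?ltr0n// ler_nat.
rewrite UF -arc_massK.
have -> : m \o F = EFin \o (fun n => arc_mass m (t - n.+1%:R^-1)).
  by apply/funext => n /=; rewrite arc_massK.
move=> /fine_cvgP[_] /cvgrPdist_lt /(_ _ e0) [n _ /(_ n (leqnn n)) /= h].
exists n.+1%:R^-1; first by rewrite invr_gt0 ltr0n.
move=> s /andP[s1 s2].
have /arc_mass_nondecreasing h1 := ltW s1; have h2 := arc_mass_nondecreasing s2.
by move: h; rewrite !ger0_norm ?subr_ge0// 1?(le_trans h1)//; lra.
Qed.

Lemma measurable_arc_mass_arg :
  measurable_fun [set: circle R] (fun x => arc_mass m (circle_arg x)).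
Proof.
apply: (measurableT_comp (f := arc_mass m)); last exact: measurable_circle_arg.
by apply: nondecreasing_measurable => // s t; exact: arc_mass_nondecreasing.
Qed.

Lemma arc_mass_le (s : R) : arc_mass m s <= fine (m setT).
Proof.
rewrite -lee_fin arc_massK fineK ?finite_measure_fin_num//.
by apply: le_measure; rewrite ?inE//; exact: measurable_arc.
Qed.

End finite_measure_arcs.

Lemma jordan_finite d (T : measurableType d) (R : realType)
    (mu : {charge set T -> \bar R}) :
  (jordan_pos (hahn_posneg mu) setT < +oo)%E /\
  (jordan_neg (hahn_posneg mu) setT < +oo)%E.
Proof. by split; rewrite -ge0_fin_numE// fin_num_measure. Qed.

(** * Invariance as an equality of two positive measures *)

Section invariance.
Variables (R : realType) (N : nat) (N_ge1 : (1 <= N)%N).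
Implicit Types (m : {measure set (circle R) -> \bar R}).

Definition pow_image m : {measure set (circle R) -> \bar R} :=
  measure_function_pushforward__canonical__measure_function_Measure
    m (@measurable_circle_pow R N).

Lemma measurable_pow_preimage (A : set (circle R)) :
  measurable A -> measurable (circle_pow N @^-1` A).
Proof.
by move=> mA; rewrite -[X in measurable X]setTI; exact: measurable_circle_pow.
Qed.

Lemma haar_arc (s : R) : 0 <= s <= 2 * pi -> arc_mass haar s = s / (2 * pi).
Proof.
move=> /andP[s0 s2]; rewrite /arc_mass /haar.
rewrite (_ : _ `&` _ = `[0, s[%classic); last first.
  apply/seteqP; split=> t; rewrite /circle_arc/= !in_itv/=.
    by case=> + t02; rewrite expiK// => ts; move: t02 => /andP[->].
  move=> /andP[t0 ts]; have t2 := lt_le_trans ts s2.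
  by rewrite expiK t0.
rewrite lebesgue_measure_itv/= lte_fin; case: ltP => s0'.
  by rewrite -EFinB -EFinM /= subr0 mulrC.
by rewrite mule0 /= (le_anti (introT andP (conj s0' s0))) mul0r.
Qed.

(** Checked on arcs: the preimage of an arc of length [s] consists of [N] arcs of length [s / N]. *)
Lemma haar_pow (A : set (circle R)) :
  measurable A -> haar (circle_pow N @^-1` A) = haar A.
Proof.
have haarT1 : haar [set: circle R] = 1%E by exact: probability_setT.
apply: (@measure_arc_unique _ (pow_image haar) haar).
  by rewrite /pow_image/= /pushforward preimage_setT haarT1 ltry.
move=> s; rewrite /pow_image/= /pushforward.
have [s0|s0] := leP s 0; first by rewrite arc_le0// preimage_set0.
have [s2|s2] := leP (2 * pi) s; first by rewrite arc_ge2pi// preimage_setT.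
have mF (B : set (circle R)) : measurable B -> haar B \is a fin_num.
  apply: finite_measure_fin_num.
  by have : (haar [set: circle R] < +oo)%E by rewrite haarT1 ltry.
have p0 := pi2_gt0 R; have N0 := natN_gt0 R N_ge1.
rewrite -[LHS]fineK ?mF//; last exact: measurable_pow_arc.
rewrite -[RHS]fineK ?mF//; last exact: measurable_arc.
congr EFin; rewrite -/(arc_mass haar s).
have s02 : 0 <= s <= 2 * pi by rewrite !ltW.
rewrite haar_arc//.
(* The arc count is stated for charges, so Haar measure is first viewed as one. *)
have := pow_arc_mass N_ge1 (charge_of_finite_measure haar) s02.
rewrite /charge_of_finite_measure => ->.
rewrite (eq_bigr (fun=> s / N%:R / (2 * pi))).
  rewrite sumr_const card_ord -(mulr_natl (s / N%:R / (2 * pi)) N) mulrA.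
  by congr (_ / _); rewrite mulrC divfK// gt_eqF.
move=> k _; have kN : (k < N)%N by [].
have /andP[h1 h2] := root_angle_itv R N_ge1 kN.
have h3 : 0 <= (2 * pi * k%:R + s) / N%:R.
  by rewrite divr_ge0 ?addr_ge0 ?mulr_ge0 ?pi_ge0// ltW.
have h4 : (2 * pi * k%:R + s) / N%:R < 2 * pi.
  rewrite ltr_pdivrMr//.
  have : k.+1%:R <= N%:R :> R by rewrite ler_nat.
  by rewrite -(natr1 k) -(ler_pM2l p0); lra.
rewrite !haar_arc ?h1 ?h3 ?(ltW h2) ?(ltW h4)//.
by rewrite -mulrBl; congr (_ / _); rewrite -mulrBl addrC addKr.
Qed.

Variable mu : {charge set (circle R) -> \bar R}.
Let p : {measure set (circle R) -> \bar R} := jordan_pos (hahn_posneg mu).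
Let n : {measure set (circle R) -> \bar R} := jordan_neg (hahn_posneg mu).

Lemma jordanE (A : set (circle R)) : measurable A -> mu A = (p A - n A)%E.
Proof. by move=> mA; rewrite (jordan_decomp (hahn_posneg mu) mA) /cadd/= cscaleN1. Qed.

(** Moving the negative parts across the equality leaves a finite positive measure on each side, to
    which uniqueness theorems for measures apply. *)
Definition invariant_lhs : {measure set (circle R) -> \bar R} :=
  measure_add (pow_image p) n.
Definition invariant_rhs : {measure set (circle R) -> \bar R} :=
  measure_add p (pow_image n).

Lemma invariant_lhsE A : invariant_lhs A = (p (circle_pow N @^-1` A) + n A)%E.
Proof. exact: measure_addE. Qed.

Lemma invariant_rhsE A : invariant_rhs A = (p A + n (circle_pow N @^-1` A))%E.
Proof. exact: measure_addE. Qed.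

Lemma invariant_lhsT : (invariant_lhs setT < +oo)%E.
Proof.
by rewrite invariant_lhsE preimage_setT lte_add_pinfty//; have [] := jordan_finite mu.
Qed.

Lemma invariant_rhsT : (invariant_rhs setT < +oo)%E.
Proof.
by rewrite invariant_rhsE preimage_setT lte_add_pinfty//; have [] := jordan_finite mu.
Qed.

Lemma power_invariantP : power_invariant mu N <->
  forall A, measurable A -> invariant_lhs A = invariant_rhs A.
Proof.
have fp (A : set (circle R)) : measurable A -> p A \is a fin_num.
  exact: fin_num_measure.
have fn (A : set (circle R)) : measurable A -> n A \is a fin_num.
  exact: fin_num_measure.
split=> h A mA; have := h A mA; have mB := measurable_pow_preimage mA;
  rewrite /pushforward -/(circle_pow N) invariant_lhsE invariant_rhsE !jordanE//;
  rewrite -(fineK (fp _ mA)) -(fineK (fn _ mA)) -(fineK (fp _ mB)) -(fineK (fn _ mB));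
  rewrite -!EFinB -!EFinD => -[?]; congr EFin; lra.
Qed.

Lemma arc_massB s : arc_mass mu s = arc_mass p s - arc_mass n s.
Proof.
rewrite /arc_mass jordanE; last exact: measurable_arc.
by rewrite fineB// fin_num_measure//; exact: measurable_arc.
Qed.

(** By the Jordan decomposition, [cmf mu] is a difference of two monotone functions of the angle. *)
Lemma measurable_cmf : measurable_fun [set: circle R] (cmf mu).
Proof.
have -> : cmf mu = (fun x => arc_mass p (circle_arg x) - arc_mass n (circle_arg x)).
  by apply/funext => x; rewrite cmfE arc_massB.
by have [fp fn] := jordan_finite mu; apply: measurable_funB;
  exact: measurable_arc_mass_arg.
Qed.

Lemma bounded_cmf : exists B, forall x, `|cmf mu x| <= B.
Proof.
have [fp fn] := jordan_finite mu.
exists (fine (p setT) + fine (n setT)) => x; rewrite cmfE arc_massB.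
have := arc_mass_le fp (circle_arg x); have := arc_mass_le fn (circle_arg x).
have := arc_mass_ge0 p (circle_arg x); have := arc_mass_ge0 n (circle_arg x).
by move=> h1 h2 h3 h4; rewrite ler_norml; apply/andP; split; lra.
Qed.

End invariance.

(** * The functional equation of the cumulative mass function *)

Lemma bounded_integrable d (T : measurableType d) (R : realType) (D : set T)
    (mD : measurable D) (m : {measure set T -> \bar R}) (mDfin : (m D < +oo)%E)
    (f : T -> R) (B : R) : measurable_fun D f ->
  (forall x, D x -> `|f x| <= B) -> m.-integrable D (EFin \o f).
Proof.
move=> mf fB; apply: measurable_bounded_integrable => //.
by exists B; split=> [|M BM x Dx /=]; rewrite ?num_real// (le_trans (fB _ Dx))// ltW.
Qed.

Section functional_equation.
Variables (R : realType) (N : nat) (N_ge1 : (1 <= N)%N).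
Variable mu : {charge set (circle R) -> \bar R}.
Let alpha := invariant_lhs N mu.
Let beta := invariant_rhs N mu.
Let sum_roots (f : circle R -> R) : R :=
  \sum_(zeta \in [set zeta : circle R | (zeta ^+ N)%g = 1%g]) f zeta.

Lemma cmf_pow_sum eta : power_invariant mu N ->
  cmf mu (eta ^+ N)%g = sum_roots (fun zeta => cmf mu (zeta * eta)%g)
    - sum_roots (cmf mu).
Proof.
move=> inv; rewrite /sum_roots sum_cmf_roots// addrK cmfE /arc_mass -[in LHS]inv//.
exact: measurable_arc.
Qed.

Lemma haar_finite : (haar [set: circle R] < +oo)%E.
Proof.
by have -> : haar [set: circle R] = 1%E by [exact: probability_setT]; rewrite ltry.
Qed.

(** A change of variables, applied below to the power map and to rotations. *)
Lemma haar_Rintegral_comp (phi : circle R -> circle R) (f : circle R -> R) :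
  measurable_fun setT phi ->
  (forall A, measurable A -> haar (phi @^-1` A) = haar A) ->
  measurable_fun setT f -> (exists B, forall x, `|f x| <= B) ->
  \int[haar]_x f (phi x) = \int[haar]_x f x.
Proof.
move=> mphi hphi mf [B fB].
rewrite /Rintegral; congr fine.
rewrite -[LHS](@integral_pushforward _ _ _ _ R phi mphi haar setT (EFin \o f))//.
- apply: eq_measure_integral => A mA _; exact: hphi.
- exact/measurable_EFinP.
- rewrite preimage_setT.
  apply: (bounded_integrable measurableT haar_finite (B := B)) => //.
  exact: measurableT_comp.
Qed.

Lemma haar_integrable (f : circle R -> R) :
  measurable_fun setT f -> (exists B, forall x, `|f x| <= B) ->
  haar.-integrable setT (EFin \o f).
Proof.
by move=> mf [B fB]; exact: (bounded_integrable measurableT haar_finite mf).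
Qed.

Lemma measurable_circle_mul (y : circle R) :
  measurable_fun setT (fun x : circle R => (y * x)%g).
Proof.
rewrite (_ : (fun x => _) = expi \o (fun x => circle_arg y + circle_arg x)); last first.
  by apply/funext => x /=; rewrite expiD !circle_argK.
apply: measurableT_comp; first exact: measurable_expi.
by apply: measurable_funD => //; exact: measurable_circle_arg.
Qed.

(** The functional equation is integrated against Haar measure: the power map preserves it, so one
    side gives [cmf_mean mu + S], and rotations preserve it, so the other gives [N] times
    [cmf_mean mu]. *)
Lemma sum_roots_mean : power_invariant mu N ->
  sum_roots (cmf mu) = (N%:R - 1) * cmf_mean mu.
Proof.
move=> inv; set S := sum_roots _.
have e eta : cmf mu (circle_pow N eta) + S =
    \sum_(k < N) cmf mu (circle_root R N k * eta)%g.
  by rewrite /circle_pow cmf_pow_sum// subrK /sum_roots sum_roots_ord.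
have cm := measurable_cmf mu; have cb := bounded_cmf mu.
have cpow : \int[haar]_x cmf mu (circle_pow N x) = cmf_mean mu.
  apply: haar_Rintegral_comp => //; first exact: measurable_circle_pow.
  by move=> A mA; exact: haar_pow.
have croot k : \int[haar]_x cmf mu (circle_root R N k * x)%g = cmf_mean mu.
  apply: haar_Rintegral_comp => //; first exact: measurable_circle_mul.
  by move=> A mA; exact: haar_invariant.
have : \int[haar]_x (cmf mu (circle_pow N x) + S) =
    \int[haar]_x (\sum_(k < N) cmf mu (circle_root R N k * x)%g).
  by apply: eq_Rintegral => x _; exact: e.
have iroot k :
    haar.-integrable setT (EFin \o (fun x => cmf mu (circle_root R N k * x)%g)).
  apply: haar_integrable.
    by apply: (measurableT_comp cm); exact: measurable_circle_mul.
  by have [B h] := cb; exists B.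
rewrite RintegralD//; last 2 first.
- apply: haar_integrable.
    by apply: (measurableT_comp cm); exact: measurable_circle_pow.
  by have [B h] := cb; exists B.
- by apply: haar_integrable => //; exists `|S|.
rewrite Rintegral_cst// cpow.
have -> : fine (haar [set: circle R]) = 1 by rewrite (@probability_setT _ _ _ haar).
have sumE n : \int[haar]_x (\sum_(k < n) cmf mu (circle_root R N k * x)%g) =
    n%:R * cmf_mean mu.
  elim: n => [|n IH].
    under eq_Rintegral do rewrite big_ord0.
    by rewrite Rintegral_cst// !mul0r.
  under eq_Rintegral do rewrite big_ord_recr /=.
  rewrite RintegralD//; last first.
    have := @integrable_sum _ _ _ haar setT measurableT 'I_n (index_enum _) xpredT
      (fun k => EFin \o (fun x => cmf mu (circle_root R N k * x)%g)).
    move=> /(_ (fun k _ => iroot k)); apply: eq_integrable => // x _.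
    by rewrite /= sumEFin.
  by rewrite IH croot -natr1 mulrDl mul1r.
by rewrite sumE mulr1 mulrBl mul1r => <-; rewrite addrC addKr.
Qed.

(** Expresses the defect of invariance on an arc through two positive measures, for which left
    continuity is available. *)
Lemma invariant_arc_massB s :
  arc_mass beta s - arc_mass alpha s =
  arc_mass mu s - fine (mu (circle_pow N @^-1` circle_arc s)).
Proof.
have mA := measurable_arc (s : R); have mB := measurable_pow_arc N (s : R).
rewrite arc_massB jordanE// /arc_mass /alpha /beta invariant_lhsE invariant_rhsE.
have [fp fn] := jordan_finite mu.
have pf := finite_measure_fin_num fp; have nf := finite_measure_fin_num fn.
rewrite fineB ?pf ?nf// !fineD ?pf ?nf//; ring.
Qed.

(** The equation at [eta] says that [beta - alpha] takes the value [c] on the arc from 1 to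
    [eta ^+ N]. This value extends to all arcs of length in []0, 2 pi]], where it must be 0. *)
Lemma cmf_pow_sum_converse c0 : {ae haar, forall eta : circle R,
    cmf mu (eta ^+ N)%g = sum_roots (fun zeta => cmf mu (zeta * eta)%g) - c0} ->
  power_invariant mu N.
Proof.
have N0 := natN_gt0 R N_ge1; have p0 := pi2_gt0 R.
move=> [Z [mZ Z0 subZ]]; apply/(power_invariantP N mu).
have aT : (alpha setT < +oo)%E by exact: invariant_lhsT.
have bT : (beta setT < +oo)%E by exact: invariant_rhsT.
pose c := sum_roots (cmf mu) - c0.
(* Lengths where the difference is [c] accumulate at [t] from the left. Otherwise the null set [Z]
   would contain every point of angle [u] with [N * u] just below [t], a set of positive Haar
   measure. *)
have dense t e : 0 < t <= 2 * pi -> 0 < e -> exists2 s, t - e < s <= t &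
    arc_mass beta s - arc_mass alpha s = c.
  move=> /andP[t0 t2] e0; apply: contrapT => noS.
  have : (haar Z > 0)%E; last by rewrite Z0 ltxx.
  (* The maximum with 0 keeps the angles in [[0, 2 pi[], the range on which [haar] measures. *)
  pose a := Num.max (t - e) 0 / N%:R.
  have a0 : 0 <= a by rewrite divr_ge0// ?le_max ?lexx ?orbT// ltW.
  have ta : a < t / N%:R.
    by rewrite ltr_pM2r ?invr_gt0// gt_max t0 andbT ltrBlDr ltrDl.
  have tN : t / N%:R <= 2 * pi.
    by rewrite ler_pdivrMr// (le_trans t2)// ler_peMr ?(ltW p0)// ler1n.
  rewrite /haar mule_gt0// ?lte_fin ?invr_gt0//.
  apply: (@lt_le_trans _ _ (lebesgue_measure `]a, t / N%:R[%classic)).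
    by rewrite lebesgue_measure_itv/= lte_fin ta -EFinB lte_fin subr_gt0.
  apply: le_measure; rewrite ?inE//.
    apply: measurableI => //.
    by rewrite -[X in measurable X]setTI; exact: measurable_expi.
  move=> u /=; rewrite !in_itv/= => /andP[au ut].
  split; last by rewrite (le_trans a0 (ltW au)) (lt_le_trans ut tN).
  apply: subZ => /= h; apply: noS; exists (N%:R * u).
    move: au ut; rewrite ltr_pdivrMr// ltr_pdivlMr// [u * _]mulrC gt_max.
    by move=> /andP[-> _] /ltW ->.
  have Nu : 0 <= N%:R * u < 2 * pi.
    rewrite mulr_ge0 ?(ltW N0) ?(le_trans a0 (ltW au))//=.
    by move: ut; rewrite ltr_pdivlMr// [u * _]mulrC => /lt_le_trans; apply.
  move: h; rewrite /sum_roots sum_cmf_roots// /circle_pow -expiMn cmfE expiK// => h.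
  by rewrite invariant_arc_massB h /c /sum_roots; ring.
(* Left continuity of each of the two masses costs [e / 2]; a good length [s] is taken within both
   moduli. *)
have key t : 0 < t <= 2 * pi -> arc_mass beta t - arc_mass alpha t = c.
  move=> t02; apply/eqP; rewrite -subr_eq0 -normr_le0; apply/ler_addgt0Pl => e e0.
  have e20 : 0 < e / 2 by rewrite divr_gt0.
  have [d1 d10 h1] := arc_mass_left_continuous aT t e20.
  have [d2 d20 h2] := arc_mass_left_continuous bT t e20.
  have d0 : 0 < Num.min d1 d2 by rewrite lt_min d10 d20.
  have [s /andP[s1 s2] sc] := dense t _ t02 d0.
  have {h1} := h1 s; have {h2} := h2 s; rewrite s2 !andbT addr0.
  move: s1; rewrite ltrBlDr => s1.
  have [sd1 sd2] : t - d1 < s /\ t - d2 < s.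
    split; rewrite ltrBlDr (lt_le_trans s1)// lerD2l ge_min lexx ?orbT//.
  move=> /(_ sd2) h2 /(_ sd1) h1; rewrite -sc.
  rewrite (_ : _ - _ = (arc_mass beta t - arc_mass beta s)
    - (arc_mass alpha t - arc_mass alpha s)); last by ring.
  by rewrite (le_trans (ler_normB _ _))// ltW// [e]splitr ltrD.
(* At length [2 pi] the arc is the whole circle, which is its own preimage, so both measures give it
   the same mass. *)
have c_eq0 : c = 0.
  rewrite -(key (2 * pi)) ?p0 ?lexx// /arc_mass arc_ge2pi// /alpha /beta.
  by rewrite invariant_lhsE invariant_rhsE preimage_setT subrr.
apply: measure_arc_unique => // s.
have [s0|s0] := leP s 0; first by rewrite arc_le0// !measure0.
wlog s2 : s s0 / s <= 2 * pi => [th|].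
  have [s2|/ltW s2] := leP s (2 * pi); first exact: th.
  by rewrite arc_ge2pi// -(@arc_ge2pi _ (2 * pi)) ?lexx//; apply: th.
rewrite -!arc_massK//; congr EFin; apply/esym/eqP; rewrite -subr_eq0 key ?c_eq0//.
by rewrite s0.
Qed.

Theorem invariant_iff_cmf_equation :
  (power_invariant mu N <->
     exists c0 : R, {ae haar, forall eta : circle R,
       cmf mu (eta ^+ N)%g = sum_roots (fun zeta => cmf mu (zeta * eta)%g) - c0}) /\
  (power_invariant mu N ->
     forall c0 : R, {ae haar, forall eta : circle R,
       cmf mu (eta ^+ N)%g = sum_roots (fun zeta => cmf mu (zeta * eta)%g) - c0} ->
     (forall eta : circle R,
       cmf mu (eta ^+ N)%g = sum_roots (fun zeta => cmf mu (zeta * eta)%g) - c0) /\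
     c0 = sum_roots (cmf mu) /\ c0 = (N%:R - 1) * cmf_mean mu).
Proof.
split; first split.
- move=> inv; exists (sum_roots (cmf mu)); apply/aeW => eta; exact: cmf_pow_sum.
- by move=> [c0]; exact: cmf_pow_sum_converse.
move=> inv c0 h.
suff -> : c0 = sum_roots (cmf mu).
  split; last by rewrite -sum_roots_mean.
  by move=> eta; exact: cmf_pow_sum.
have haarT0 : (0 < haar [set: circle R])%E.
  by have -> : haar [set: circle R] = 1%E by exact: probability_setT.
(* Haar measure is nonzero, so the almost everywhere equation holds at some point; comparison there
   with the pointwise equation determines [c0]. *)
have [eta e] : exists eta : circle R,
    cmf mu (eta ^+ N)%g = sum_roots (fun zeta => cmf mu (zeta * eta)%g) - c0.
  have [Z [mZ Z0 sub]] := h; apply: contrapT => no.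
  suff ZT : Z = setT by move: haarT0; rewrite -ZT Z0 ltxx.
  rewrite -subTset => x _; apply: sub => /= ex; apply: no; by exists x.
by move: (cmf_pow_sum eta inv); rewrite e => /addrI /oppr_inj.
Qed.

End functional_equation.

(** * Complex integrals against charges *)

Section complex_lemmas.
Variable R : realType.
Implicit Types z w : R[i].

Lemma ReM z w : complex.Re (z * w) =
  complex.Re z * complex.Re w - complex.Im z * complex.Im w.
Proof. by case: z w => a b [c d]. Qed.

Lemma ImM z w : complex.Im (z * w) =
  complex.Re z * complex.Im w + complex.Im z * complex.Re w.
Proof. by case: z w => a b [c d]. Qed.

Lemma normc_le_ReIm z : `|z| <= (`|complex.Re z| + `|complex.Im z|)%:C.
Proof.
case: z => a b; rewrite normc_def lecR /=.
rewrite -(@ler_pXn2r _ 2)// ?nnegrE ?sqrtr_ge0 ?addr_ge0// sqr_sqrtr ?addr_ge0 ?sqr_ge0//.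
by rewrite [leRHS]sqrrD !real_normK ?num_real// lerD2r lerDl mulrn_wge0 ?mulr_ge0.
Qed.

Lemma normc_Re_le z (B : R) : `|z| <= B%:C -> `|complex.Re z| <= B.
Proof. by rewrite lecE => /andP[_ h]; apply: le_trans h; exact: (normc_ReIm z).1. Qed.

Lemma normc_Im_le z (B : R) : `|z| <= B%:C -> `|complex.Im z| <= B.
Proof. by rewrite lecE => /andP[_ h]; apply: le_trans h; exact: (normc_ReIm z).2. Qed.

End complex_lemmas.

Section complex_integral.
Context d (T : measurableType d) (R : realType).
Variable D : set T.
Variable mD : measurable D.
Implicit Types f g : T -> R[i].

Definition cmeasurable f : Prop :=
  measurable_fun D (fun x => complex.Re (f x)) /\
  measurable_fun D (fun x => complex.Im (f x)).

Definition cbounded f : Prop := exists B : R, forall x, D x -> `|f x| <= B%:C.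

Lemma cmeasurable_cst c : cmeasurable (fun=> c).
Proof. by split; exact: measurable_cst. Qed.

Lemma cmeasurableD f g : cmeasurable f -> cmeasurable g ->
  cmeasurable (fun x => f x + g x).
Proof.
move=> [f1 f2] [g1 g2]; split.
- under [X in measurable_fun _ X]eq_fun do rewrite raddfD.
  exact: measurable_funD.
- under [X in measurable_fun _ X]eq_fun do rewrite raddfD.
  exact: measurable_funD.
Qed.

Lemma cmeasurableM f g : cmeasurable f -> cmeasurable g ->
  cmeasurable (fun x => f x * g x).
Proof.
move=> [f1 f2] [g1 g2]; split.
- under [X in measurable_fun _ X]eq_fun do rewrite ReM.
  by apply: measurable_funB; exact: measurable_funM.
- under [X in measurable_fun _ X]eq_fun do rewrite ImM.
  by apply: measurable_funD; exact: measurable_funM.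
Qed.

Lemma cmeasurableX f n : cmeasurable f -> cmeasurable (fun x => f x ^+ n).
Proof.
move=> mf; elim: n => [|n IH].
  by under [X in cmeasurable X]eq_fun do rewrite expr0; exact: cmeasurable_cst.
by under [X in cmeasurable X]eq_fun do rewrite exprS; exact: cmeasurableM.
Qed.

Lemma cmeasurable_sum n (F : nat -> T -> R[i]) :
  (forall i, cmeasurable (F i)) -> cmeasurable (fun x => \sum_(i < n) F i x).
Proof.
move=> mF; elim: n => [|n IH].
  by under [X in cmeasurable X]eq_fun do rewrite big_ord0; exact: cmeasurable_cst.
by under [X in cmeasurable X]eq_fun do rewrite big_ord_recr; exact: cmeasurableD.
Qed.

Lemma cbounded_cst c : cbounded (fun=> c).
Proof. by exists (`|complex.Re c| + `|complex.Im c|) => x _; exact: normc_le_ReIm. Qed.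

Lemma cboundedD f g : cbounded f -> cbounded g -> cbounded (fun x => f x + g x).
Proof.
move=> [A fA] [B gB]; exists (A + B) => x Dx.
by rewrite rmorphD (le_trans (ler_normD _ _))// lerD ?fA ?gB.
Qed.

Lemma cboundedM f g : cbounded f -> cbounded g -> cbounded (fun x => f x * g x).
Proof.
move=> [A fA] [B gB]; exists (A * B) => x Dx.
by rewrite rmorphM normrM ler_pM ?normr_ge0 ?fA ?gB.
Qed.

Lemma cboundedX f n : cbounded f -> cbounded (fun x => f x ^+ n).
Proof.
move=> bf; elim: n => [|n IH].
  by under [X in cbounded X]eq_fun do rewrite expr0; exact: cbounded_cst.
by under [X in cbounded X]eq_fun do rewrite exprS; exact: cboundedM.
Qed.

Lemma cbounded_sum n (F : nat -> T -> R[i]) :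
  (forall i, cbounded (F i)) -> cbounded (fun x => \sum_(i < n) F i x).
Proof.
move=> mF; elim: n => [|n IH].
  by under [X in cbounded X]eq_fun do rewrite big_ord0; exact: cbounded_cst.
by under [X in cbounded X]eq_fun do rewrite big_ord_recr; exact: cboundedD.
Qed.

Variable m : {measure set T -> \bar R}.
Variable mDfin : (m D < +oo)%E.

Lemma cintegrable_Re f : cmeasurable f -> cbounded f ->
  m.-integrable D (EFin \o (fun x => complex.Re (f x))).
Proof.
move=> [mf _] [B fB]; apply: (bounded_integrable mD mDfin (B := B)) => // x Dx.
exact/normc_Re_le/fB.
Qed.

Lemma cintegrable_Im f : cmeasurable f -> cbounded f ->
  m.-integrable D (EFin \o (fun x => complex.Im (f x))).
Proof.
move=> [_ mf] [B fB]; apply: (bounded_integrable mD mDfin (B := B)) => // x Dx.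
exact/normc_Im_le/fB.
Qed.

Lemma cintegralD f g : cmeasurable f -> cbounded f -> cmeasurable g -> cbounded g ->
  cintegral m D (fun x => f x + g x) = cintegral m D f + cintegral m D g.
Proof.
move=> mf bf mg bg; rewrite /cintegral.
under eq_Rintegral do rewrite raddfD.
under [X in _ +i* X]eq_Rintegral do rewrite raddfD.
rewrite RintegralD//; [|exact: cintegrable_Re..].
by rewrite RintegralD//; exact: cintegrable_Im.
Qed.

Lemma cintegralZ c f : cmeasurable f -> cbounded f ->
  cintegral m D (fun x => c * f x) = c * cintegral m D f.
Proof.
move=> mf bf; have iRe := cintegrable_Re mf bf; have iIm := cintegrable_Im mf bf.
have iZ (a : R) (h : T -> R) : m.-integrable D (EFin \o h) ->
    m.-integrable D (EFin \o (fun x => a * h x)).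
  by move=> ih; have := integrableZl mD a ih; apply: eq_integrable => // x _;
    rewrite /= EFinM.
rewrite /cintegral.
under eq_Rintegral do rewrite ReM.
under [X in _ +i* X]eq_Rintegral do rewrite ImM.
rewrite RintegralB ?RintegralD ?RintegralZl//; [|exact: iZ..].
by case: c.
Qed.

Lemma cintegral_sum n (F : nat -> T -> R[i]) :
  (forall i, cmeasurable (F i)) -> (forall i, cbounded (F i)) ->
  cintegral m D (fun x => \sum_(i < n) F i x) = \sum_(i < n) cintegral m D (F i).
Proof.
move=> mF bF; elim: n => [|n IH].
  rewrite big_ord0 /cintegral.
  under eq_Rintegral do rewrite big_ord0.
  under [X in _ +i* X]eq_Rintegral do rewrite big_ord0.
  by rewrite /= Rintegral_cst// mul0r.
rewrite big_ord_recr /= -IH -cintegralD//.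
- by congr cintegral; apply/funext => x; rewrite big_ord_recr.
- exact: cmeasurable_sum.
- exact: cbounded_sum.
Qed.

(** The factor 2 comes from bounding real and imaginary parts separately; it is harmless because the
    bound only serves for remainders. *)
Lemma cintegral_norm_le f (B : R) : cmeasurable f ->
  (forall x, D x -> `|f x| <= B%:C) ->
  `|cintegral m D f| <= (2 * B * fine (m D))%:C.
Proof.
move=> mf fB; have bf : cbounded f by exists B.
have bnd (h : T -> R) : measurable_fun D h -> (forall x, D x -> `|h x| <= B) ->
    `|\int[m]_(x in D) h x| <= B * fine (m D).
  move=> mh hB; have ih := bounded_integrable mD mDfin mh hB.
  rewrite (le_trans (le_normr_Rintegral mD ih))// -Rintegral_cst//.
  apply: le_Rintegral => //.
  - apply: (bounded_integrable mD mDfin (B := B)); first exact: measurableT_comp.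
    by move=> x Dx; rewrite normr_id hB.
  - apply: (bounded_integrable mD mDfin (B := `|B|)) => //.
apply: le_trans (normc_le_ReIm _) _; rewrite lecR /= -mulrA mulr_natl mulr2n lerD//.
- by apply: bnd => [|x Dx]; [case: mf|exact/normc_Re_le/fB].
- by apply: bnd => [|x Dx]; [case: mf|exact/normc_Im_le/fB].
Qed.

Lemma eq_cintegral f g : (forall x, D x -> f x = g x) ->
  cintegral m D f = cintegral m D g.
Proof.
move=> fg; rewrite /cintegral; congr (_ +i* _); apply: eq_Rintegral => x /[1!inE] Dx;
  by rewrite fg.
Qed.

End complex_integral.

(** * Integrals against a signed measure *)

Section charge_integral.
Context d (T : measurableType d) (R : realType).
Variable mu : {charge set T -> \bar R}.
Implicit Types f g : T -> R[i].

Lemma charge_cintegralD f g : cmeasurable setT f -> cbounded setT f ->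
  cmeasurable setT g -> cbounded setT g ->
  charge_cintegral mu (fun x => f x + g x) =
  charge_cintegral mu f + charge_cintegral mu g.
Proof.
move=> mf bf mg bg; have [pT nT] := jordan_finite mu.
by rewrite /charge_cintegral !cintegralD// opprD addrACA.
Qed.

Lemma charge_cintegralZ c f : cmeasurable setT f -> cbounded setT f ->
  charge_cintegral mu (fun x => c * f x) = c * charge_cintegral mu f.
Proof.
move=> mf bf; have [pT nT] := jordan_finite mu.
by rewrite /charge_cintegral !cintegralZ// -mulrBr.
Qed.

Lemma charge_cintegral_sum k (F : nat -> T -> R[i]) :
  (forall i, cmeasurable setT (F i)) -> (forall i, cbounded setT (F i)) ->
  charge_cintegral mu (fun x => \sum_(i < k) F i x) =
  \sum_(i < k) charge_cintegral mu (F i).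
Proof.
move=> mF bF; have [pT nT] := jordan_finite mu.
by rewrite /charge_cintegral !cintegral_sum// sumrB.
Qed.

(** [K] is twice the total variation of [mu], independent of the integrand. *)
Lemma charge_cintegral_norm_le : exists2 K : R, 0 <= K &
  forall f (B : R), cmeasurable setT f -> (forall x, `|f x| <= B%:C) ->
  `|charge_cintegral mu f| <= (K * B)%:C.
Proof.
have [pT nT] := jordan_finite mu.
exists (2 * fine (jordan_pos (hahn_posneg mu) setT)
  + 2 * fine (jordan_neg (hahn_posneg mu) setT)).
  by rewrite addr_ge0// mulr_ge0// fine_ge0.
move=> f B mf fB; rewrite /charge_cintegral (le_trans (ler_normB _ _))//.
rewrite mulrDl rmorphD lerD//.
- rewrite [2 * _ * _]mulrAC; exact: cintegral_norm_le.
- rewrite [2 * _ * _]mulrAC; exact: cintegral_norm_le.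
Qed.

Lemma charge_cintegral1 : charge_cintegral mu (fun=> 1) = (fine (mu setT))%:C.
Proof.
rewrite /charge_cintegral /cintegral /= !Rintegral_cst// !mul1r !mul0r.
rewrite (jordan_decomp (hahn_posneg mu) measurableT) /cadd/= cscaleN1.
have [pT nT] := jordan_finite mu.
rewrite fineB ?ge0_fin_numE//.
by apply/eqP; rewrite eq_complex /= subrr !eqxx.
Qed.

End charge_integral.

(** * Uniqueness of Fourier coefficients *)

Section threshold.
Variable R : realType.

Lemma bernoulli_inequality (y : R) n : -1 <= y -> 1 + n%:R * y <= (1 + y) ^+ n.
Proof.
move=> y1; elim: n => [|n IH]; first by rewrite mul0r addr0 expr0.
have y10 : 0 <= 1 + y by lra.
rewrite exprS (le_trans _ (ler_wpM2l y10 IH))// -(natr1 n).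
have : 0 <= n%:R * (y * y) by rewrite mulr_ge0// -expr2 sqr_ge0.
by lra.
Qed.

Lemma cvg_natr_expr (q : R) : 0 <= q < 1 -> (n%:R * q ^+ n) @[n --> \oo] --> 0.
Proof.
move=> /andP[q0 q1].
have [q_eq0|qn0] := eqVneq q 0.
  apply/cvgrPdist_lt => e e0; near=> n.
  have n0 : (0 < n)%N by near: n; exists 1%N.
  by rewrite q_eq0 expr0n gtn_eqF// mulr0 subr0 normr0.
have q_gt0 : 0 < q by rewrite lt_neqAle eq_sym qn0.
(* With [r] halfway between [q] and 1 and [r / q = 1 + a], Bernoulli gives [n a <= (r / q)^n], hence
   [n q^n <= r^n / a]. *)
pose r := (1 + q) / 2; pose a := r / q - 1.
have r1 : r < 1 by rewrite /r; lra.
have r0 : 0 < r by rewrite /r; lra.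
have a0 : 0 < a by rewrite /a subr_gt0 ltr_pdivlMr// mul1r /r; lra.
apply: (@squeeze_cvgr _ _ _ _ (fun=> 0) (fun n => a^-1 * r ^+ n)).
- near=> n; apply/andP; split; first by rewrite mulr_ge0// exprn_ge0.
  rewrite ler_pdivlMl// mulrA -[X in _ <= X ^+ _](divfK qn0) exprMn.
  rewrite ler_wpM2r ?exprn_ge0//.
  have an1 : -1 <= a by lra.
  have := bernoulli_inequality n an1; rewrite [1 + a]addrC subrK [a * _]mulrC; lra.
- exact: cvg_cst.
- rewrite -[X in _ --> X](mulr0 a^-1); apply: cvgMr.
  by apply: cvg_expr; rewrite ger0_norm// ltW.
Unshelve. all: by end_near. Qed.

(** Approximates an indicator by polynomials, as in elementary proofs of the Stone-Weierstrass
    theorem: composed with an affine function of the coordinates, they remain trigonometric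
    polynomials. *)
Definition threshold (n : nat) (x : R) := (1 - x ^+ n.+1) ^+ (n.+1 * 2 ^ n.+1)%N.

Lemma threshold_itv n x : 0 <= x <= 1 -> 0 <= threshold n x <= 1.
Proof.
move=> /andP[x0 x1]; have h : 0 <= 1 - x ^+ n.+1 by rewrite subr_ge0 exprn_ile1.
by rewrite exprn_ge0// exprn_ile1// gerBl exprn_ge0.
Qed.

(* The exponent [n 2^n] grows faster than [2^n] but [n 2^n x^n -> 0] for
   [x < 1/2], so the limit at [1/2] itself is [0]. *)
Lemma threshold_cvg x : 0 <= x <= 1 ->
  threshold n x @[n --> \oo] --> ((x < 1 / 2)%R%:R : R).
Proof.
move=> x01; have /andP[x0 x1] := x01; have [xlt|xge] := ltP x (1 / 2).
  have q01 : 0 <= 2 * x < 1 by apply/andP; split; lra.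
  apply: (@squeeze_cvgr _ _ _ _ (fun n => 1 - n.+1%:R * (2 * x) ^+ n.+1) (fun=> 1)).
  - near=> n; have /andP[_ ->] := threshold_itv n x01; rewrite andbT.
    (* Bernoulli bounds [threshold n x] below by [1 - (n + 1) (2 x)^(n + 1)]. *)
    have := @bernoulli_inequality (- x ^+ n.+1) (n.+1 * 2 ^ n.+1)%N.
    rewrite lerN2 exprn_ile1// => /(_ isT); apply: le_trans.
    by rewrite mulrN natrM natrX exprMn mulrA.
  - rewrite -[X in _ --> X]subr0; apply: cvgB; first exact: cvg_cst.
    have := cvg_natr_expr q01.
    by rewrite -(cvg_shiftS (fun n => n%:R * (2 * x) ^+ n)).
  - exact: cvg_cst.
apply: (@squeeze_cvgr _ _ _ _ (fun=> 0) (fun n => harmonic n)).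
- near=> n; have /andP[-> _] /= := threshold_itv n x01.
  (* Here [k y = n + 1], so [(1 + y)^k >= n + 1] by Bernoulli. Since [(1 - y)^k (1 + y)^k <= 1], the
     value is at most [1 / (n + 1)]. *)
  set k := (n.+1 * 2 ^ n.+1)%N; pose y := (1 / 2 : R) ^+ n.+1.
  have y0 : 0 < y by rewrite exprn_gt0//; lra.
  have y1 : y <= 1 by rewrite exprn_ile1//; lra.
  have yx : y <= x ^+ n.+1 by rewrite lerXn2r// ?nnegrE; lra.
  have h1 : threshold n x <= (1 - y) ^+ k.
    apply: lerXn2r; rewrite ?nnegrE ?subr_ge0 ?y1 ?exprn_ile1//.
    by rewrite lerD2l lerN2.
  apply: le_trans h1 _; rewrite /harmonic /= -[leRHS]mul1r ler_pdivlMr ?ltr0n//.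
  have ky : k%:R * y = n.+1%:R.
    have two_half : 2 * (1 / 2) = 1 :> R by lra.
    by rewrite /k natrM natrX -mulrA -exprMn two_half expr1n mulr1.
  have h2 : n.+1%:R <= (1 + y) ^+ k.
    apply: (@le_trans _ _ (1 + k%:R * y)); first by rewrite ky; lra.
    by apply: bernoulli_inequality; lra.
  have h0 : 0 <= (1 - y) ^+ k by rewrite exprn_ge0// subr_ge0.
  apply: le_trans (ler_wpM2l h0 h2) _; rewrite -exprMn exprn_ile1//.
    by rewrite mulr_ge0//; lra.
  by have := mulr_ge0 (ltW y0) (ltW y0); lra.
- exact: cvg_cst.
- exact: cvg_harmonic.
Unshelve. all: by end_near. Qed.

End threshold.

(** * From equal Fourier coefficients to equal measures *)

Section fourier_uniqueness.
Variable R : realType.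
Variables m1 m2 : {measure set (circle R) -> \bar R}.
Variables (m1T : (m1 setT < +oo)%E) (m2T : (m2 setT < +oo)%E).

Let z (x : circle R) : R[i] := circle_val x.
Let zi (x : circle R) : R[i] := (circle_val x)^-1.

Lemma cmeasurable_circle : cmeasurable setT z.
Proof. by split; [exact: measurable_circle_Re|exact: measurable_circle_Im]. Qed.

Lemma circle_val_inv (x : circle R) :
  (circle_val x)^-1 = complex.Re (circle_val x) -i* complex.Im (circle_val x).
Proof.
rewrite -(circle_argK x) -[LHS]/(circle_val (expi (circle_arg x))^-1%g).
have -> : ((expi (circle_arg x))^-1)%g = expi (- circle_arg x) :> circle R.
  by rewrite -(sub0r (circle_arg x)) expiB expi0 mul1g.
by rewrite /= cosN sinN.
Qed.

Lemma cmeasurable_circleV : cmeasurable setT zi.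
Proof.
split.
- rewrite (_ : (fun x => _) = (fun x => complex.Re (circle_val x))).
    exact: measurable_circle_Re.
  by apply/funext => x; rewrite /zi circle_val_inv.
- rewrite (_ : (fun x => _) = (fun x => - complex.Im (circle_val x))).
    by apply: measurable_funN; exact: measurable_circle_Im.
  by apply/funext => x; rewrite /zi circle_val_inv.
Qed.

Lemma norm_circle (x : circle R) : `|circle_val x| = 1.
Proof. exact/eqP/circle_norm. Qed.

Lemma cbounded_circle : cbounded setT z.
Proof. by exists 1 => x _; rewrite norm_circle. Qed.

Lemma cbounded_circleV : cbounded setT zi.
Proof. by exists 1 => x _; rewrite /zi normfV norm_circle invr1. Qed.

Variable moments : forall k, cintegral m1 setT (fun x => zi x ^+ k) =
                             cintegral m2 setT (fun x => zi x ^+ k).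

Lemma cmeasurable_monomial i j : cmeasurable setT (fun x => z x ^+ i * zi x ^+ j).
Proof.
apply: cmeasurableM; apply: cmeasurableX.
  exact: cmeasurable_circle.
exact: cmeasurable_circleV.
Qed.

Lemma cbounded_monomial i j : cbounded setT (fun x => z x ^+ i * zi x ^+ j).
Proof.
apply: cboundedM; apply: cboundedX.
  exact: cbounded_circle.
exact: cbounded_circleV.
Qed.

(** The measures are real and inversion on the circle is conjugation, so opposite coefficients are
    conjugate. *)
Lemma moments_pos k : cintegral m1 setT (fun x => z x ^+ k) =
                      cintegral m2 setT (fun x => z x ^+ k).
Proof.
have ck (m : {measure set (circle R) -> \bar R}) : (m setT < +oo)%E ->
   cintegral m setT (fun x => z x ^+ k) = conjc (cintegral m setT (fun x => zi x ^+ k)).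
  move=> mT.
  have zc x : z x ^+ k = conjc (zi x ^+ k).
    rewrite rmorphXn/=; congr (_ ^+ _); rewrite /zi circle_val_inv /z.
    by case: (circle_val x) => a b; rewrite /= opprK.
  apply/eqP; rewrite eq_complex /cintegral /=; apply/andP; split; apply/eqP.
    by apply: eq_Rintegral => x _; rewrite zc; case: (zi x ^+ k).
  rewrite -mulN1r -RintegralZl//.
    by apply: eq_Rintegral => x _; rewrite zc mulN1r; case: (zi x ^+ k).
  apply: cintegrable_Im => //.
    by apply: cmeasurableX; exact: cmeasurable_circleV.
  by apply: cboundedX; exact: cbounded_circleV.
by rewrite !ck// moments.
Qed.

Lemma moments_monomial i j : cintegral m1 setT (fun x => z x ^+ i * zi x ^+ j) =
                             cintegral m2 setT (fun x => z x ^+ i * zi x ^+ j).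
Proof.
have z0 x : z x * zi x = 1 by rewrite /z /zi divff// circle_neq0.
case: (leqP j i) => [ji|/ltnW ij].
  have e x : z x ^+ i * zi x ^+ j = z x ^+ (i - j).
    by rewrite -{1}(subnK ji) exprD -mulrA -exprMn z0 expr1n mulr1.
  rewrite (eq_cintegral m1 (fun x _ => e x)) (eq_cintegral m2 (fun x _ => e x)).
  exact: moments_pos.
have e x : z x ^+ i * zi x ^+ j = zi x ^+ (j - i).
  by rewrite -{1}(subnKC ij) exprD mulrA -exprMn z0 expr1n mul1r.
rewrite (eq_cintegral m1 (fun x _ => e x)) (eq_cintegral m2 (fun x _ => e x)).
exact: moments.
Qed.

(** Testing against all monomials, and not only the constant 1, makes the property stable under
    multiplication by [z] and [zi]. Powers of trigonometric polynomials are then reached by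
    induction, without expanding them. *)
Definition same_moments (f : circle R -> R[i]) : Prop :=
  [/\ cmeasurable setT f, cbounded setT f &
   forall i j, cintegral m1 setT (fun x => f x * (z x ^+ i * zi x ^+ j)) =
               cintegral m2 setT (fun x => f x * (z x ^+ i * zi x ^+ j))].

Lemma same_moments1 : same_moments (fun=> 1).
Proof.
split; [exact: cmeasurable_cst|exact: cbounded_cst|move=> i j].
have e x : 1 * (z x ^+ i * zi x ^+ j) = z x ^+ i * zi x ^+ j by rewrite mul1r.
rewrite (eq_cintegral m1 (fun x _ => e x)) (eq_cintegral m2 (fun x _ => e x)).
exact: moments_monomial.
Qed.

Lemma same_momentsD f g : same_moments f -> same_moments g ->
  same_moments (fun x => f x + g x).
Proof.
move=> [mf bf hf] [mg bg hg].
split; [exact: cmeasurableD|exact: cboundedD|move=> i j].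
have e x : (f x + g x) * (z x ^+ i * zi x ^+ j) =
  f x * (z x ^+ i * zi x ^+ j) + g x * (z x ^+ i * zi x ^+ j) by rewrite mulrDl.
rewrite (eq_cintegral m1 (fun x _ => e x)) (eq_cintegral m2 (fun x _ => e x)).
have mm := cmeasurable_monomial i j; have bm := cbounded_monomial i j.
rewrite !cintegralD ?hf ?hg//; by [exact: cmeasurableM|exact: cboundedM].
Qed.

Lemma same_momentsZ c f : same_moments f -> same_moments (fun x => c * f x).
Proof.
move=> [mf bf hf]; split.
- by apply: cmeasurableM => //; exact: cmeasurable_cst.
- by apply: cboundedM => //; exact: cbounded_cst.
move=> i j.
have e x : c * f x * (z x ^+ i * zi x ^+ j) =
  c * (f x * (z x ^+ i * zi x ^+ j)) by rewrite !mulrA.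
rewrite (eq_cintegral m1 (fun x _ => e x)) (eq_cintegral m2 (fun x _ => e x)).
have mm := cmeasurable_monomial i j; have bm := cbounded_monomial i j.
by rewrite !cintegralZ ?hf//; [exact: cmeasurableM|exact: cboundedM|
  exact: cmeasurableM|exact: cboundedM].
Qed.

Lemma same_momentsz f : same_moments f -> same_moments (fun x => z x * f x).
Proof.
move=> [mf bf hf]; split.
- by apply: cmeasurableM => //; exact: cmeasurable_circle.
- by apply: cboundedM => //; exact: cbounded_circle.
move=> i j.
have e x : z x * f x * (z x ^+ i * zi x ^+ j) = f x * (z x ^+ i.+1 * zi x ^+ j).
  by rewrite exprS; ring.
by rewrite (eq_cintegral m1 (fun x _ => e x)) (eq_cintegral m2 (fun x _ => e x)).
Qed.

Lemma same_momentszi f : same_moments f -> same_moments (fun x => zi x * f x).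
Proof.
move=> [mf bf hf]; split.
- by apply: cmeasurableM => //; exact: cmeasurable_circleV.
- by apply: cboundedM => //; exact: cbounded_circleV.
move=> i j.
have e x : zi x * f x * (z x ^+ i * zi x ^+ j) = f x * (z x ^+ i * zi x ^+ j.+1).
  by rewrite exprS; ring.
by rewrite (eq_cintegral m1 (fun x _ => e x)) (eq_cintegral m2 (fun x _ => e x)).
Qed.

Section cap.
Variables t s : R.
Variable s1 : -1 <= s <= 1.

(* Affine in [Re (x e^{-it})], valued in [0, 1], and [< 1/2] exactly on the cap. *)
Definition cap_height (x : circle R) : R :=
  (s - (cos t * complex.Re (circle_val x) + sin t * complex.Im (circle_val x))) / 4
  + 1 / 2.

Lemma cap_height_itv x : 0 <= cap_height x <= 1.
Proof.
rewrite /cap_height -(circle_argK x) /= [cos t * _]mulrC [sin t * _]mulrC -cosB.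
have := cos_le1 (circle_arg x - t); have := cos_geN1 (circle_arg x - t).
by have /andP[sa sb] := s1; move=> h1 h2; apply/andP; split; lra.
Qed.

Lemma cap_heightE x : circle_cap t s x <-> cap_height x < 1 / 2.
Proof. by rewrite /circle_cap /cap_height /=; split; lra. Qed.

Lemma same_moments_height f : same_moments f ->
  same_moments (fun x => (cap_height x)%:C * f x).
Proof.
move=> hf.
(* The coefficient is [-1/4], from [cap_height], times the [1/2] in [Re u = (u + conj u) / 2] for
   [u = x e^{-it}]. *)
pose c : R[i] := (- (1 / 8))%:C.
pose g x := (s / 4 + 1 / 2)%:C * f x + (c * (cos t +i* sin t) * (zi x * f x)
      + c * (cos t -i* sin t) * (z x * f x)).
have -> : (fun x => (cap_height x)%:C * f x) = g.
  apply/funext => x; rewrite /g.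
  rewrite !mulrA -!mulrDl; congr (_ * _); rewrite /zi circle_val_inv /z /cap_height.
  case: (circle_val x) => a b; apply/eqP; rewrite eq_complex /=.
  by apply/andP; split; apply/eqP; field.
apply: same_momentsD; first exact: same_momentsZ.
apply: same_momentsD; apply: same_momentsZ.
  exact: same_momentszi.
exact: same_momentsz.
Qed.

Lemma same_moments_threshold n : same_moments (fun x => (threshold n (cap_height x))%:C).
Proof.
(* Two inductions: first on powers of [cap_height], then on powers of [1 - cap_height ^+ n.+1]. *)
have powM f k : same_moments f -> same_moments (fun x => (cap_height x ^+ k)%:C * f x).
  move=> hf; elim: k => [|k IH].
    rewrite (_ : (fun x => _ * f x) = f)//; apply/funext => x.
    by rewrite expr0 mul1r.
  rewrite (_ : (fun x => _ * f x) =
    (fun x => (cap_height x)%:C * ((cap_height x ^+ k)%:C * f x))).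
    exact: same_moments_height.
  by apply/funext => x; rewrite exprS rmorphM mulrA.
rewrite /threshold; elim: (_ * _)%N => [|k IH].
  rewrite (_ : (fun x => _) = (fun=> 1)); first exact: same_moments1.
  by apply/funext => x; rewrite expr0.
rewrite (_ : (fun x => _) = (fun x => ((1 - cap_height x ^+ n.+1) ^+ k)%:C
   + (-1) * ((cap_height x ^+ n.+1)%:C * ((1 - cap_height x ^+ n.+1) ^+ k)%:C))).
  by apply: same_momentsD => //; apply: same_momentsZ; exact: powM.
by apply/funext => x; rewrite exprS rmorphM rmorphB /=; ring.
Qed.

Lemma measurable_threshold n : measurable_fun setT (fun x => threshold n (cap_height x)).
Proof. by have [[]] := same_moments_threshold n. Qed.

Lemma threshold_integral n :
  (\int[m1]_x (threshold n (cap_height x))%:E =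
   \int[m2]_x (threshold n (cap_height x))%:E)%E.
Proof.
have [_ _ /(_ 0%N 0%N)] := same_moments_threshold n.
have e x : (threshold n (cap_height x))%:C * (z x ^+ 0 * zi x ^+ 0) =
  (threshold n (cap_height x))%:C by rewrite !expr0 !mulr1.
rewrite (eq_cintegral m1 (fun x _ => e x)) (eq_cintegral m2 (fun x _ => e x)).
rewrite /cintegral => -[] /= {}e _; move: e; rewrite /Rintegral => e.
have fin (m : {measure set (circle R) -> \bar R}) : (m setT < +oo)%E ->
    (\int[m]_x (threshold n (cap_height x))%:E)%E \is a fin_num.
  move=> mT; apply: integrable_fin_num => //.
  apply: (bounded_integrable measurableT mT (B := 1)); first exact: measurable_threshold.
  move=> x _; have /andP[h0 h1] := threshold_itv n (cap_height_itv x).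
  by rewrite ger0_norm.
by rewrite -[LHS]fineK ?fin// -[RHS]fineK ?fin// e.
Qed.

(** Dominated convergence with bound 1: the thresholds of [cap_height] tend pointwise to the
    indicator of the cap. *)
Lemma threshold_integral_cvg (m : {measure set (circle R) -> \bar R}) :
  (m setT < +oo)%E ->
  (\int[m]_x (threshold n (cap_height x))%:E)%E @[n --> \oo] --> m (circle_cap t s).
Proof.
move=> mT.
have mcap := measurable_cap t s.
have -> : m (circle_cap t s) = (\int[m]_x (\1_(circle_cap t s) x)%:E)%E.
  by rewrite integral_indic// setIT.
have [] := @dominated_convergence _ _ R m setT measurableT
  (fun n x => (threshold n (cap_height x))%:E)
  (fun x => (\1_(circle_cap t s) x)%:E) (cst 1%E) => //.
- by move=> n; apply/measurable_EFinP; exact: measurable_threshold.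
- by apply/measurable_EFinP; exact: measurable_indic.
- apply/aeW => x _; apply/cvg_EFin; first by near=> n.
  rewrite /= indicE (_ : (x \in circle_cap t s) = (cap_height x < 1 / 2)); last first.
    by apply/idP/idP => [/set_mem/cap_heightE|/cap_heightE/mem_set].
  exact/threshold_cvg/cap_height_itv.
- apply: (@bounded_integrable _ _ R setT measurableT m mT (fun=> 1) 1) => // x _.
  by rewrite normr1.
- apply/aeW => x n _ /=; have /andP[h0 h1] := threshold_itv n (cap_height_itv x).
  by rewrite lee_fin ger0_norm.
Unshelve. all: by end_near. Qed.

Lemma eq_measure_cap : m1 (circle_cap t s) = m2 (circle_cap t s).
Proof.
have h1 := threshold_integral_cvg m1T; have h2 := threshold_integral_cvg m2T.
rewrite -(cvg_lim _ h1)// -(cvg_lim _ h2)//; congr (lim (_ @ \oo)).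
by apply/funext => n; exact: threshold_integral.
Qed.

End cap.

(** An arc is the point 1 together with a cap, and the point is the complement of a cap. Caps are
    settled by [eq_measure_cap], total masses by the coefficient of index 0. *)
Theorem fourier_measure_unique (A : set (circle R)) : measurable A -> m1 A = m2 A.
Proof.
apply: measure_arc_unique => // s.
have eT : m1 setT = m2 setT.
  have := moments 0; rewrite /cintegral => -[] /= + _.
  rewrite !Rintegral_cst// !mul1r => e.
  by rewrite -[LHS]fineK ?ge0_fin_numE// e fineK ?ge0_fin_numE.
have [s0|s0] := leP s 0; first by rewrite arc_le0// !measure0.
have [s2|s2] := leP (2 * pi) s; first by rewrite arc_ge2pi.
have cosb : -1 <= cos (s / 2) <= 1 by rewrite cos_geN1 cos_le1.
rewrite cap_arcE ?s0// !measureU//;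
  try (by exact: measurable_cap || exact: measurable_set1_circle).
- congr (_ + _)%E; last exact: eq_measure_cap.
  have mc := measurable_cap (pi : R) (-1).
  rewrite set1_capE -![~` _]setTD !measureD// !setTI.
  congr (_ - _)%E; first exact: eT.
  by apply: eq_measure_cap; lra.
all: apply/seteqP; split => // x [/= ->]; rewrite circle_capE circle_arg1 sub0r cosN.
all: by rewrite ltxx.
Qed.

End fourier_uniqueness.

(** * Power series expansion of the Herglotz primitive *)

Section herglotz_expansion.
Variable R : realType.

(** The substitution [t -> 1 - t] reduces it to the integral of [(1 - t)^n]. *)
Lemma Rintegral_expr n :
  \int[@lebesgue_measure R]_(t in `[0, 1]) (t ^+ n) = n.+1%:R^-1.
Proof.
rewrite -Rintegral_onemXn (Rintegration_by_substitution_onem (G := fun t : R => t ^+ n)).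
- by rewrite /unstable.onem subrr.
- by rewrite ler01 lexx.
- by apply: continuous_in_subspaceT => x _; exact: exprn_continuous.
Qed.

(** Gives measurability of the Cauchy kernel and of the segment integrand below, both uniform limits
    of polynomial expressions. *)
Lemma cmeasurable_lim d (T : measurableType d) (D : set T)
    (F : nat -> T -> R[i]) (f : T -> R[i]) (e : R ^nat) :
  (forall n, cmeasurable D (F n)) ->
  (forall n x, D x -> `|f x - F n x| <= (e n)%:C) ->
  e n @[n --> \oo] --> 0 -> cmeasurable D f.
Proof.
move=> mF fF e0.
have cv (h : nat -> R) l : (forall n, `|l - h n| <= e n) -> h n @[n --> \oo] --> l.
  move=> hl; apply/cvgrPdist_lt => r r0; near=> n.
  apply: le_lt_trans (hl n) _; apply: le_lt_trans (ler_norm _) _.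
  rewrite -normrN -sub0r; near: n; exact: (cvgrPdist_lt _ _).1 e0 _ r0.
split.
- apply: (measurable_fun_cvg (h := fun n x => complex.Re (F n x))) => [n|x Dx].
    by case: (mF n).
  by apply: cv => n; rewrite -raddfB; exact/normc_Re_le/fF.
- apply: (measurable_fun_cvg (h := fun n x => complex.Im (F n x))) => [n|x Dx].
    by case: (mF n).
  by apply: cv => n; rewrite -raddfB; exact/normc_Im_le/fF.
Unshelve. all: by end_near. Qed.

(** The norm of [R[i]] takes values in [R[i]]; estimates are carried out with this real version. *)
Definition cmod (z : R[i]) : R := complex.Re `|z|.

Lemma cmodE z : `|z| = (cmod z)%:C.
Proof. by rewrite /cmod normc_def. Qed.

Lemma cmod_ge0 z : 0 <= cmod z.
Proof. by rewrite -ler0c -cmodE normr_ge0. Qed.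

Lemma cmod_lt1 z : (`|z| < 1) = (cmod z < 1).
Proof. by rewrite cmodE -ltcR. Qed.

Lemma cmod_le z (B : R) : (`|z| <= B%:C) = (cmod z <= B).
Proof. by rewrite cmodE lecR. Qed.

Lemma cmodM z w : cmod (z * w) = cmod z * cmod w.
Proof. by apply/(@complexI R); rewrite rmorphM -!cmodE normrM. Qed.

Lemma cmodX z n : cmod (z ^+ n) = cmod z ^+ n.
Proof. by apply/(@complexI R); rewrite rmorphXn -!cmodE normrX. Qed.

Lemma cmodV z : cmod z^-1 = (cmod z)^-1.
Proof. by apply/(@complexI R); rewrite fmorphV -!cmodE normfV. Qed.

Lemma cmodD z w : cmod (z + w) <= cmod z + cmod w.
Proof. by rewrite -cmod_le rmorphD /= -!cmodE ler_normD. Qed.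

Lemma cmodB z w : cmod (z - w) <= cmod z + cmod w.
Proof. by rewrite -cmod_le rmorphD /= -!cmodE ler_normB. Qed.

Lemma cmod_real (x : R) : cmod x%:C = `|x|.
Proof. by rewrite /cmod normc_def /= expr0n addr0 sqrtr_sqr. Qed.

Lemma cmod_circle (x : circle R) : cmod (circle_val x) = 1.
Proof. by apply/(@complexI R); rewrite -cmodE norm_circle. Qed.

Lemma cmod_eq0 z : (cmod z == 0) = (z == 0).
Proof. by rewrite -(inj_eq (@complexI R)) -cmodE normr_eq0. Qed.

Lemma cmod_sum n (F : nat -> R[i]) : cmod (\sum_(i < n) F i) <= \sum_(i < n) cmod (F i).
Proof.
elim: n => [|n IH]; first by rewrite !big_ord0 /cmod normr0.
by rewrite !big_ord_recr/= (le_trans (cmodD _ _))// lerD2r.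
Qed.

Let zi (x : circle R) : R[i] := (circle_val x)^-1.

Definition cauchy_kernel (w : R[i]) (x : circle R) : R[i] := (circle_val x - w)^-1.

Lemma circle_sub_neq0 w (x : circle R) : `|w| < 1 -> circle_val x - w != 0.
Proof.
move=> w1; rewrite subr_eq0; apply/eqP => e.
by move: w1; rewrite -e norm_circle ltxx.
Qed.

Lemma cauchy_kernel_cmod_le w (x : circle R) : `|w| < 1 ->
  cmod (cauchy_kernel w x) <= (1 - cmod w)^-1.
Proof.
move=> w1; have := w1; rewrite cmod_lt1 => q1.
rewrite cmodV lef_pV2 ?posrE ?subr_gt0//; last first.
  by rewrite lt_neqAle eq_sym cmod_eq0 circle_sub_neq0// cmod_ge0.
rewrite lerBlDr -[leLHS](cmod_circle x).
by rewrite -{1}(subrK w (circle_val x)) cmodD.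
Qed.

(** The geometric series of ratio [w / x], stopped after [n] terms; keeping the remainder exact
    avoids infinite sums. *)
Lemma cauchy_kernel_expand w (x : circle R) n : `|w| < 1 ->
  cauchy_kernel w x = \sum_(i < n) w ^+ i * zi x ^+ i.+1
    + w ^+ n * zi x ^+ n * cauchy_kernel w x.
Proof.
move=> w1; have x0 := circle_neq0 x; have xw0 := circle_sub_neq0 x w1.
elim: n => [|n IH]; first by rewrite big_ord0 add0r !expr0 !mul1r.
rewrite big_ord_recr /= -addrA {1}IH; congr (_ + _).
rewrite /zi /cauchy_kernel !exprSr mulrA -!mulrA -mulrDr; congr (_ * _).
rewrite ![w * _]mulrCA -mulrDr; congr (_ * _).
by field; rewrite x0 xw0.
Qed.

Lemma cauchy_kernel_dist w (x : circle R) n : `|w| < 1 ->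
  `|cauchy_kernel w x - \sum_(i < n) w ^+ i * zi x ^+ i.+1|
    <= (cmod w ^+ n / (1 - cmod w))%:C.
Proof.
move=> w1; rewrite {1}(cauchy_kernel_expand x n w1) addrAC subrr add0r cmod_le.
rewrite !cmodM !cmodX /zi cmodV cmod_circle invr1 expr1n mulr1.
by rewrite ler_wpM2l ?exprn_ge0 ?cmod_ge0 ?cauchy_kernel_cmod_le.
Qed.

Lemma cmeasurable_kernel_sum w n :
  cmeasurable setT (fun x => \sum_(i < n) w ^+ i * zi x ^+ i.+1).
Proof.
apply: (cmeasurable_sum n (F := fun i x => w ^+ i * zi x ^+ i.+1)) => i.
apply: cmeasurableM; first exact: cmeasurable_cst.
by apply: cmeasurableX; exact: cmeasurable_circleV.
Qed.

Lemma cvg_geometric_bound (q : R) : 0 <= q < 1 ->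
  (q ^+ n / (1 - q)) @[n --> \oo] --> 0.
Proof.
move=> /andP[q0 q1]; rewrite -[X in _ --> X](mul0r (1 - q)^-1).
by apply: cvgMl; apply: cvg_expr; rewrite ger0_norm.
Qed.

Lemma cmeasurable_kernel w : `|w| < 1 -> cmeasurable setT (cauchy_kernel w).
Proof.
move=> w1; apply: (cmeasurable_lim (F := fun n x => \sum_(i < n) w ^+ i * zi x ^+ i.+1)
    (e := fun n => cmod w ^+ n / (1 - cmod w))).
- by move=> n; exact: cmeasurable_kernel_sum.
- by move=> n x _; exact: cauchy_kernel_dist.
- by apply: cvg_geometric_bound; rewrite cmod_ge0 -cmod_lt1.
Qed.

Lemma cbounded_kernel w : `|w| < 1 -> cbounded setT (cauchy_kernel w).
Proof.
by move=> w1; exists (1 - cmod w)^-1 => x _; rewrite cmod_le cauchy_kernel_cmod_le.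
Qed.

Variable mu : {charge set (circle R) -> \bar R}.

Definition fourier_coef (j : nat) : R[i] :=
  charge_cintegral mu (fun x => zi x ^+ j).

Definition cauchy_transform (w : R[i]) : R[i] :=
  charge_cintegral mu (cauchy_kernel w).

(** Integrates the kernel expansion termwise. The constant depends on [mu] alone, which allows
    integration along segments and, later, a choice of [z] in terms of it. *)
Lemma cauchy_transform_approx : exists2 K : R, 0 <= K & forall w n, `|w| < 1 ->
  cmod (cauchy_transform w - \sum_(i < n) w ^+ i * fourier_coef i.+1)
    <= K * (cmod w ^+ n / (1 - cmod w)).
Proof.
have [K K0 hK] := charge_cintegral_norm_le mu; exists K => // w n w1.
have mm i : cmeasurable setT (fun x => zi x ^+ i).
  by apply: cmeasurableX; exact: cmeasurable_circleV.
have bb i : cbounded setT (fun x => zi x ^+ i).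
  by apply: cboundedX; exact: cbounded_circleV.
have e : \sum_(i < n) w ^+ i * fourier_coef i.+1 =
    charge_cintegral mu (fun x => \sum_(i < n) w ^+ i * zi x ^+ i.+1).
  rewrite (@charge_cintegral_sum _ _ _ mu n (fun i x => w ^+ i * zi x ^+ i.+1)).
  - by apply: eq_bigr => i _; rewrite charge_cintegralZ.
  - by move=> i; apply: cmeasurableM => //; exact: cmeasurable_cst.
  - by move=> i; apply: cboundedM => //; exact: cbounded_cst.
have ms := cmeasurable_kernel_sum w n.
have mNs : cmeasurable setT (fun x => (-1) * \sum_(i < n) w ^+ i * zi x ^+ i.+1).
  by apply: cmeasurableM => //; exact: cmeasurable_cst.
have bs : cbounded setT (fun x => \sum_(i < n) w ^+ i * zi x ^+ i.+1).
  apply: (cbounded_sum n (F := fun i x => w ^+ i * zi x ^+ i.+1)) => i.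
  by apply: cboundedM => //; exact: cbounded_cst.
have bNs : cbounded setT (fun x => (-1) * \sum_(i < n) w ^+ i * zi x ^+ i.+1).
  by apply: cboundedM => //; exact: cbounded_cst.
have mk := cmeasurable_kernel w1; have bk := cbounded_kernel w1.
rewrite e -mulN1r -charge_cintegralZ// /cauchy_transform -charge_cintegralD//.
rewrite -cmod_le; apply: hK; first exact: cmeasurableD.
by move=> x; rewrite mulN1r; exact: cauchy_kernel_dist.
Qed.

(** From [(x + w) / (x - w) = 1 + 2 w / (x - w)]. *)
Lemma herglotzE w : `|w| < 1 ->
  herglotz mu w = (fine (mu setT))%:C + 2 * w * cauchy_transform w.
Proof.
move=> w1; rewrite -charge_cintegral1 /cauchy_transform.
have mk := cmeasurable_kernel w1; have bk := cbounded_kernel w1.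
have m1 := cmeasurable_cst [set: circle R] (1 : R[i]).
have b1 := cbounded_cst [set: circle R] (1 : R[i]).
have mZ : cmeasurable setT (fun x => 2 * w * cauchy_kernel w x).
  by apply: cmeasurableM => //; exact: cmeasurable_cst.
have bZ : cbounded setT (fun x => 2 * w * cauchy_kernel w x).
  by apply: cboundedM => //; exact: cbounded_cst.
rewrite -charge_cintegralZ// -charge_cintegralD// /herglotz; congr charge_cintegral.
apply/funext => x; have := circle_sub_neq0 x w1; rewrite /cauchy_kernel => xw0.
by field.
Qed.

(** The primitive without its factor [1 / (2 pi i)], which cancels from the functional equation. *)
Definition herglotz_segment (z : R[i]) : R[i] :=
  segment_integral (fun w => (herglotz mu w - (fine (mu setT))%:C) / w) 0 z.

(** On the segment the integrand is [2 z] times the Cauchy transform at [t z]; integrating its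
    expansion in [t] produces the factors [1 / (i + 1)]. *)
Lemma herglotz_segment_approx : exists2 K : R, 0 <= K & forall z n, `|z| < 1 ->
  cmod (herglotz_segment z
      - 2 * \sum_(i < n) z ^+ i.+1 * (fourier_coef i.+1 / i.+1%:R))
    <= K * (cmod z ^+ n.+1 / (1 - cmod z)).
Proof.
(* One factor 2 comes from [2 z], the other from [cintegral_norm_le]. *)
have [K K0 hK] := cauchy_transform_approx; exists (4 * K); first by rewrite mulr_ge0.
move=> z n z1; have q0 := cmod_ge0 z; have q1 : cmod z < 1 by rewrite -cmod_lt1.
have p1 : 0 < 1 - cmod z by rewrite subr_gt0.
(* The endpoint 0 is removed: there the original integrand divides by 0 and takes the default value
   0, not its holomorphic extension. A single point does not affect the integral. *)
set D : set R := `]0, 1]%classic.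
have mD : measurable D by exact: measurable_itv.
have Dfin : (@lebesgue_measure R D < +oo)%E.
  by rewrite lebesgue_measure_itv/= lte_fin ltr01 -EFinB ltry.
have D1 : fine (@lebesgue_measure R D) = 1.
  by rewrite lebesgue_measure_itv/= lte_fin ltr01 -EFinB /= subr0.
pose F (t : R) : R[i] := 2 * z * cauchy_transform (t%:C * z).
pose G i (t : R) : R[i] := 2 * z ^+ i.+1 * fourier_coef i.+1 * t%:C ^+ i.
pose P m (t : R) : R[i] := \sum_(i < m) G i t.
have FP m t : D t -> `|F t - P m t| <= (2 * K * (cmod z ^+ m.+1 / (1 - cmod z)))%:C.
  rewrite /D /= in_itv/= => /andP[t0 t1].
  have tz : cmod (t%:C * z) <= cmod z.
    by rewrite cmodM cmod_real gtr0_norm// ler_piMl.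
  have tz1 : `|t%:C * z| < 1 by rewrite cmod_lt1 (le_lt_trans tz).
  rewrite (_ : F t - P m t = 2 * z * (cauchy_transform (t%:C * z)
    - \sum_(i < m) (t%:C * z) ^+ i * fourier_coef i.+1)); last first.
    rewrite /F /P [RHS]mulrBr; congr (_ - _); rewrite mulr_sumr; apply: eq_bigr => i _.
    by rewrite /G exprMn exprS; ring.
  rewrite cmod_le !cmodM (_ : cmod 2 = 2); last first.
    by rewrite (_ : 2 = 2%:C) ?cmod_real ?ger0_norm// rmorph_nat.
  rewrite -!mulrA ler_pM2l// mulrCA.
  rewrite [leRHS](_ : _ = cmod z * (K * (cmod z ^+ m / (1 - cmod z)))); last first.
    by rewrite exprS; ring.
  rewrite ler_wpM2l// (le_trans (hK _ m tz1))// ler_wpM2l//.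
  rewrite ler_pM ?exprn_ge0 ?cmod_ge0// ?invr_ge0 ?subr_ge0 ?(ltW (le_lt_trans tz q1))//.
    by rewrite lerXn2r// nnegrE cmod_ge0.
  by rewrite lef_pV2 ?posrE ?subr_gt0 ?(le_lt_trans tz q1)// lerB.
have mt : cmeasurable D (fun t : R => t%:C).
  by split; [exact: measurable_id|exact: measurable_cst].
have bt : cbounded D (fun t : R => t%:C).
  exists 1 => t; rewrite /D /= in_itv/= cmod_le cmod_real => /andP[t0 t1].
  by rewrite gtr0_norm.
have mZ c i : cmeasurable D (fun t : R => c * t%:C ^+ i).
  by apply: cmeasurableM; [exact: cmeasurable_cst|exact: cmeasurableX].
have bZ c i : cbounded D (fun t : R => c * t%:C ^+ i).
  by apply: cboundedM; [exact: cbounded_cst|exact: cboundedX].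
have mP m : cmeasurable D (P m).
  by apply: (cmeasurable_sum m (F := G)) => i; exact: mZ.
have bP m : cbounded D (P m).
  by apply: (cbounded_sum m (F := G)) => i; exact: bZ.
have mF : cmeasurable D F.
  apply: (cmeasurable_lim mP FP).
  rewrite -[X in _ --> X](mulr0 (2 * K)); apply: cvgMr.
  have := @cvg_geometric_bound (cmod z); rewrite q0 q1 => /(_ isT).
  by rewrite -(cvg_shiftS (fun n => cmod z ^+ n / (1 - cmod z))).
have bF : cbounded D F.
  exists (2 * K * (cmod z ^+ 1 / (1 - cmod z))) => t Dt.
  by have := FP 0%N t Dt; rewrite /P big_ord0 subr0.
have segE : herglotz_segment z = cintegral (@lebesgue_measure R) D F.
  pose F0 (t : R) := (herglotz mu (0 + t%:C * (z - 0)) - (fine (mu setT))%:C)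
     / (0 + t%:C * (z - 0)) * (z - 0).
  have F0E t : D t -> F0 t = F t.
    rewrite /D /= in_itv/= => /andP[t0 t1]; rewrite /F0 /F subr0 add0r.
    have [->|zn0] := eqVneq z 0; first by rewrite !(mulr0, mul0r).
    have tz1 : `|t%:C * z| < 1.
      rewrite cmod_lt1 cmodM cmod_real gtr0_norm// (le_lt_trans _ q1)//.
      by rewrite ler_piMl.
    have tn0 : t%:C != 0 :> R[i].
      by rewrite -(rmorph0 (real_complex R)) (inj_eq (@complexI R)) gt_eqF.
    by rewrite herglotzE// addrAC subrr add0r; field; rewrite ?tn0 ?zn0.
  rewrite /herglotz_segment /segment_integral -/F0 /cintegral.
  have mF0 : cmeasurable D F0.
    by case: mF => m1 m2; split; [apply: eq_measurable_fun m1|apply: eq_measurable_fun m2]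
      => t /[1!inE] Dt; rewrite F0E.
  have bF0 : cbounded D F0.
    by have [B hB] := bF; exists B => t Dt; rewrite F0E//; exact: hB.
  congr (_ +i* _).
    rewrite -Rintegral_itv_obnd_cbnd; last exact: cintegrable_Re.
    by apply: eq_Rintegral => t /[1!inE] Dt; rewrite F0E.
  rewrite -Rintegral_itv_obnd_cbnd; last exact: cintegrable_Im.
  by apply: eq_Rintegral => t /[1!inE] Dt; rewrite F0E.
have PE : cintegral (@lebesgue_measure R) D (P n) =
    2 * \sum_(i < n) z ^+ i.+1 * (fourier_coef i.+1 / i.+1%:R).
  transitivity (\sum_(i < n) cintegral (@lebesgue_measure R) D (G i)).
    by apply: cintegral_sum => // i; [exact: mZ|exact: bZ].
  rewrite mulr_sumr; apply: eq_bigr => i _; rewrite /G cintegralZ//; last 2 first.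
  - exact: cmeasurableX.
  - exact: cboundedX.
  rewrite (_ : cintegral _ _ _ = (i.+1%:R^-1)%:C).
    by rewrite fmorphV rmorph_nat; ring.
  have mi := cmeasurableX i mt; have bi := cboundedX i bt.
  rewrite /cintegral; congr (_ +i* _).
    rewrite Rintegral_itv_obnd_cbnd; last exact: cintegrable_Re.
    rewrite -Rintegral_expr; apply: eq_Rintegral => t _.
    by rewrite -rmorphXn.
  rewrite (_ : (fun t => _) = (fun=> 0)); first by rewrite Rintegral_cst// mul0r.
  by apply/funext => t; rewrite -rmorphXn.
have mN : cmeasurable D (fun t => (-1) * P n t).
  by apply: cmeasurableM => //; exact: cmeasurable_cst.
have bN : cbounded D (fun t => (-1) * P n t).
  by apply: cboundedM => //; exact: cbounded_cst.
have FPE : cintegral (@lebesgue_measure R) D (fun t => F t + (-1) * P n t) =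
    cintegral (@lebesgue_measure R) D F - cintegral (@lebesgue_measure R) D (P n).
  have mPn := mP n; have bPn := bP n.
  have -> : cintegral (@lebesgue_measure R) D (fun t => F t + (-1) * P n t) =
      cintegral (@lebesgue_measure R) D F +
      cintegral (@lebesgue_measure R) D (fun t => (-1) * P n t).
    by apply: cintegralD.
  have -> : cintegral (@lebesgue_measure R) D (fun t => (-1) * P n t) =
      (-1) * cintegral (@lebesgue_measure R) D (P n).
    by apply: cintegralZ.
  by rewrite mulN1r.
rewrite segE -PE -FPE.
rewrite -cmod_le.
have : `|cintegral (@lebesgue_measure R) D (fun t => F t + (-1) * P n t)| <=
    (2 * (2 * K * (cmod z ^+ n.+1 / (1 - cmod z)))
      * fine (@lebesgue_measure R D))%:C.
  have mPn := mP n; apply: cintegral_norm_le => //; first exact: cmeasurableD.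
  by move=> t Dt; rewrite mulN1r; exact: FP.
rewrite D1 mulr1 => /le_trans; apply; rewrite lecR le_eqVlt.
by apply/orP; left; apply/eqP; ring.
Qed.

End herglotz_expansion.

(** * Invariance in terms of Fourier coefficients *)

Section invariant_fourier.
Variables (R : realType) (N : nat) (N_ge1 : (1 <= N)%N).
Variable mu : {charge set (circle R) -> \bar R}.
Let zi (x : circle R) : R[i] := (circle_val x)^-1.
Let p : {measure set (circle R) -> \bar R} := jordan_pos (hahn_posneg mu).
Let n : {measure set (circle R) -> \bar R} := jordan_neg (hahn_posneg mu).

Lemma cintegral_measure_add (m1 m2 : {measure set (circle R) -> \bar R}) f :
  (m1 setT < +oo)%E -> (m2 setT < +oo)%E ->
  cmeasurable setT f -> cbounded setT f ->
  cintegral (measure_add m1 m2) setT f = cintegral m1 setT f + cintegral m2 setT f.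
Proof.
move=> m1T m2T mf bf.
have key (h : circle R -> R) : measurable_fun setT h ->
    m1.-integrable setT (EFin \o h) -> m2.-integrable setT (EFin \o h) ->
    \int[measure_add m1 m2]_x h x = \int[m1]_x h x + \int[m2]_x h x.
  move=> mh h1 h2; rewrite /Rintegral (integral_measure_add measurableT h1 h2).
  by rewrite fineD//; exact: integrable_fin_num.
have [mRe mIm] := mf.
rewrite /cintegral !key//; by [exact: cintegrable_Re|exact: cintegrable_Im].
Qed.

Lemma cintegral_pow_image (m : {measure set (circle R) -> \bar R}) f :
  (m setT < +oo)%E -> cmeasurable setT f -> cbounded setT f ->
  cintegral (pow_image N m) setT f = cintegral m setT (fun x => f (circle_pow N x)).
Proof.
move=> mT mf bf.
have key (h : circle R -> R) B : measurable_fun setT h -> (forall x, `|h x| <= B) ->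
    \int[pow_image N m]_x h x = \int[m]_x h (circle_pow N x).
  move=> mh hB; rewrite /Rintegral; congr fine.
  rewrite (@integral_pushforward _ _ _ _ R _ (@measurable_circle_pow R N) m setT
    (EFin \o h))//.
    exact/measurable_EFinP.
  rewrite preimage_setT; apply: (bounded_integrable measurableT mT (B := B)) => //.
  by apply: (measurableT_comp mh); exact: measurable_circle_pow.
have [mRe mIm] := mf; have [B fB] := bf.
rewrite /cintegral (key _ B mRe) ?(key _ B mIm)// => x.
  exact/normc_Im_le/fB.
exact/normc_Re_le/fB.
Qed.

(** Pushing forward by the power map turns the coefficient of index [j] into that of index
    [N * j]. *)
Lemma invariant_moment j :
  cintegral (invariant_lhs N mu) setT (fun x => zi x ^+ j) -
  cintegral (invariant_rhs N mu) setT (fun x => zi x ^+ j) =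
  fourier_coef mu (N * j) - fourier_coef mu j.
Proof.
have [pT nT] := jordan_finite mu.
have mm : cmeasurable setT (fun x => zi x ^+ j).
  by apply: cmeasurableX; exact: cmeasurable_circleV.
have bb : cbounded setT (fun x => zi x ^+ j).
  by apply: cboundedX; exact: cbounded_circleV.
have pow_fin (m : {measure set (circle R) -> \bar R}) :
    (m setT < +oo)%E -> (pow_image N m setT < +oo)%E.
  by move=> mT; rewrite /pow_image /= /pushforward preimage_setT.
have -> : cintegral (invariant_lhs N mu) setT (fun x => zi x ^+ j) =
    cintegral p setT (fun x => zi (circle_pow N x) ^+ j)
    + cintegral n setT (fun x => zi x ^+ j).
  apply: etrans (cintegral_measure_add (pow_fin _ pT) nT mm bb) _.
  by rewrite (cintegral_pow_image pT mm bb).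
have -> : cintegral (invariant_rhs N mu) setT (fun x => zi x ^+ j) =
    cintegral p setT (fun x => zi x ^+ j)
    + cintegral n setT (fun x => zi (circle_pow N x) ^+ j).
  apply: etrans (cintegral_measure_add pT (pow_fin _ nT) mm bb) _.
  by rewrite (cintegral_pow_image nT mm bb).
have -> : (fun x => zi (circle_pow N x) ^+ j) = (fun x => zi x ^+ (N * j)).
  by apply/funext => x; rewrite /zi /circle_pow circle_valX -exprVn exprM.
by rewrite /fourier_coef /charge_cintegral; ring.
Qed.

Lemma power_invariant_fourier : power_invariant mu N <->
  forall j, fourier_coef mu (N * j.+1) = fourier_coef mu j.+1.
Proof.
split=> [/power_invariantP inv j|inv].
  apply/eqP; rewrite -subr_eq0 -invariant_moment subr_eq0; apply/eqP.
  rewrite /cintegral /Rintegral.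
  by rewrite !(@eq_measure_integral _ _ _ _ (invariant_rhs N mu) (invariant_lhs N mu))//
    => A mA _; exact: inv.
apply/power_invariantP => A mA.
apply: (fourier_measure_unique (invariant_lhsT N mu) (invariant_rhsT N mu)) => // k.
(* At index 0 the condition is [c_0 = c_0], so the positive indices suffice. *)
apply/eqP; rewrite -subr_eq0 invariant_moment; case: k => [|k].
  by rewrite muln0 subrr.
by rewrite inv subrr.
Qed.

End invariant_fourier.

(** * Sums over the roots of unity *)

Section root_sums.
Variables (R : realType) (N : nat) (N_ge1 : (1 <= N)%N).

Let rt (k : nat) : R[i] := circle_val (circle_root R N k).

Lemma complex_rootE k : rt k = rt 1 ^+ k.
Proof.
rewrite /rt -circle_valX; congr circle_val; rewrite /circle_root -expiMn.
by congr expi; rewrite mulr1; ring.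
Qed.

(** A complex solution of [zeta ^+ N = 1] has modulus 1, so the enumeration on the circle already
    covers it. *)
Lemma complex_root_bij : set_bij `I_N [set zeta : R[i] | zeta ^+ N = 1] rt.
Proof.
have [f1 f2 f3] := circle_root_bij R N_ge1; split.
- move=> k kN /=; rewrite /rt -circle_valX.
  by have := f1 k kN => /= ->.
- move=> i j iN jN e; apply: f2 => //; exact/val_inj.
- move=> z /= z1.
  have nz : `|z| == 1.
    by rewrite -(@pexpr_eq1 _ _ N)// -normrX z1 normr1.
  have [k kN e] : [set circle_root R N k | k in `I_N] (Circle nz).
    apply: f3; apply: (@val_inj _ _ (circle R)).
    by rewrite -[LHS]/(circle_val (Circle nz ^+ N)%g) circle_valX.
  by exists k => //; rewrite /rt e.
Qed.

Lemma sum_complex_roots (f : R[i] -> R[i]) :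
  \sum_(zeta \in [set zeta : R[i] | zeta ^+ N = 1]) f zeta = \sum_(k < N) f (rt k).
Proof.
rewrite [RHS](fsbig_ord _ _ (fun k => f (rt k))).
by apply: reindex_fsbig; exact: complex_root_bij.
Qed.

(** A geometric sum of ratio [rt 1 ^+ j], whose [N]-th power is 1. Injectivity of the enumeration
    shows that the ratio is 1 only when [N] divides [j]. *)
Lemma sum_root_powers j : \sum_(k < N) rt k ^+ j = if (N %| j)%N then N%:R else 0.
Proof.
have [f1 f2 f3] := complex_root_bij.
have r0 : rt 0 = 1 by rewrite complex_rootE expr0.
have rN : rt 1 ^+ N = 1.
  rewrite -complex_rootE /rt /circle_root mulfK ?(lt0r_neq0 (natN_gt0 R N_ge1))//.
  by rewrite -[X in expi X]add0r expi2pi expi0.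
have e k : rt k ^+ j = (rt 1 ^+ j) ^+ k by rewrite complex_rootE -!exprM mulnC.
under eq_bigr do rewrite e.
have rj : rt 1 ^+ j = rt (j %% N).
  by rewrite {1}(divn_eq j N) exprD mulnC exprM rN expr1n mul1r -complex_rootE.
have [Nj|Nj] := boolP (N %| j)%N.
  rewrite rj (eqP Nj) r0; under eq_bigr do rewrite expr1n.
  by rewrite sumr_const card_ord.
have rj1 : rt 1 ^+ j != 1.
  apply: contra Nj; rewrite rj -r0 => /eqP h; apply/eqP.
  by apply: f2 => //; rewrite inE /= ?ltn_mod.
have := subrX1 (rt 1 ^+ j) N; rewrite -exprM mulnC exprM rN expr1n subrr.
by move=> /esym/eqP; rewrite mulf_eq0 subr_eq0 (negPf rj1) => /eqP.
Qed.

(** Each block of [N] consecutive values of [i.+1] contains exactly one multiple of [N], its last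
    element. *)
Lemma sum_multiples (V : nmodType) (g : nat -> V) m :
  \sum_(i < N * m) (if (N %| i.+1)%N then g i.+1 else 0) = \sum_(i < m) g (N * i.+1)%N.
Proof.
elim: m => [|m IH]; first by rewrite muln0 !big_ord0.
rewrite [RHS]big_ord_recr /= -IH.
rewrite -!(big_mkord xpredT (fun i => if (N %| i.+1)%N then g i.+1 else 0)).
rewrite (big_cat_nat (n := (N * m)%N))//=; last by rewrite leq_mul2l leqnSn orbT.
congr (_ + _); rewrite -{1}[(N * m)%N]add0n big_addn mulnSr addKn.
rewrite -{1}(prednK N_ge1) big_nat_recr//= big_nat big1 ?add0r.
  by rewrite -addSn prednK// dvdn_addl ?dvdn_mulr// dvdnn addnC.
move=> i /andP[_ iN]; rewrite -addSn dvdn_addl ?dvdn_mulr// gtnNdvd//.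
by rewrite -ltn_predRL.
Qed.

End root_sums.

(** * The functional equation of the Herglotz primitive *)

Section herglotz_equation.
Variables (R : realType) (N : nat) (N_ge1 : (1 <= N)%N).
Variable mu : {charge set (circle R) -> \bar R}.

Let rt (k : nat) : R[i] := circle_val (circle_root R N k).
Let c := fourier_coef mu.
Let J := herglotz_segment mu.

Let delta (z : R[i]) : R[i] := \sum_(k < N) J (rt k * z) - J (z ^+ N).

(** The expansions of [J (rt k * z)] are cut at [N * m] and that of [J (z ^+ N)] at [m], so that
    both end at degree [N * m] in [z]. Summing over the roots keeps the multiples of [N], with
    [N * (c (N i) / (N i)) = c (N i) / i]. *)
Lemma delta_approx : exists2 K : R, 0 <= K & forall z m, `|z| < 1 ->
  cmod (delta z
      - 2 * \sum_(i < m) (z ^+ N) ^+ i.+1 * ((c (N * i.+1)%N - c i.+1) / i.+1%:R))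
    <= K * (cmod z ^+ (N * m).+1 / (1 - cmod z)).
Proof.
have [K K0 hK] := herglotz_segment_approx mu.
(* There are [N] remainders from the roots and one from [z ^+ N]. *)
exists ((N.+1)%:R * K); first exact: mulr_ge0.
move=> z m z1; have q0 := cmod_ge0 z; have q1 : cmod z < 1 by rewrite -cmod_lt1.
pose a j : R[i] := c j / j%:R.
have rz k : cmod (rt k * z) = cmod z by rewrite cmodM cmod_circle mul1r.
have N0 : N%:R != 0 :> R[i] by rewrite pnatr_eq0 -lt0n.
have rsum : \sum_(k < N) \sum_(i < N * m) (rt k * z) ^+ i.+1 * a i.+1 =
    \sum_(i < m) (z ^+ N) ^+ i.+1 * (c (N * i.+1)%N / i.+1%:R).
  rewrite exchange_big /=.
  rewrite (eq_bigr (fun i : 'I_(N * m) => if (N %| i.+1)%N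
      then N%:R * (z ^+ i.+1 * a i.+1) else 0)); last first.
    move=> i _; rewrite (eq_bigr (fun k : 'I_N => rt k ^+ i.+1 * (z ^+ i.+1 * a i.+1))).
      rewrite -mulr_suml sum_root_powers//.
      by case: ifP => // _; rewrite mul0r.
    by move=> k _; rewrite exprMn -mulrA.
  rewrite (sum_multiples N_ge1 (fun i => N%:R * (z ^+ i * a i))).
  apply: eq_bigr => i _; rewrite -exprM /a natrM invfM; field.
  by rewrite N0 andbT addrC natr1 pnatr_eq0.
rewrite (_ : _ - _ =
    \sum_(k < N) (J (rt k * z) - 2 * \sum_(i < N * m) (rt k * z) ^+ i.+1 * a i.+1)
    - (J (z ^+ N) - 2 * \sum_(i < m) (z ^+ N) ^+ i.+1 * a i.+1)); last first.
  rewrite sumrB -mulr_sumr rsum /delta opprB addrACA [in RHS]addrC addrCA addrA.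
  rewrite (_ : \sum_(i < m) _ = \sum_(i < m) (z ^+ N) ^+ i.+1 * (c (N * i.+1)%N / i.+1%:R)
    - \sum_(i < m) (z ^+ N) ^+ i.+1 * a i.+1).
    by ring.
  by rewrite -sumrB; apply: eq_bigr => i _; rewrite -mulrBr -mulrBl.
apply: le_trans (cmodB _ _) _.
have -> : N.+1%:R * K * (cmod z ^+ (N * m).+1 / (1 - cmod z)) =
    (K * (cmod z ^+ (N * m).+1 / (1 - cmod z))) *+ N
    + K * (cmod z ^+ (N * m).+1 / (1 - cmod z)).
  by rewrite -mulrA mulr_natl mulrSr.
apply: lerD.
  apply: le_trans (cmod_sum N (fun k =>
    J (rt k * z) - 2 * \sum_(i < N * m) (rt k * z) ^+ i.+1 * a i.+1)) _.
  apply: (@le_trans _ _ (\sum_(k < N) K * (cmod z ^+ (N * m).+1 / (1 - cmod z)))).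
    apply: ler_sum => k _; rewrite -(rz k); apply: hK.
    by rewrite cmod_lt1 rz.
  by rewrite sumr_const card_ord.
(* Replacing [z ^+ N] by [z] in the last remainder only increases it, since
   [N (m + 1) >= N m + 1]. *)
have qN : cmod z ^+ N <= cmod z.
  by rewrite -[leRHS]expr1; apply: ler_wiXn2l => //; exact: ltW.
have zN1 : `|z ^+ N| < 1 by rewrite cmod_lt1 cmodX (le_lt_trans qN).
apply: le_trans (hK _ m zN1) _; rewrite ler_wpM2l// cmodX.
rewrite ler_pM ?exprn_ge0// ?invr_ge0 ?subr_ge0 ?(le_trans qN (ltW q1))//.
  rewrite -exprM; apply: ler_wiXn2l => //; first exact: ltW.
  by rewrite mulnS -add1n leq_add2r.
by rewrite lef_pV2 ?posrE ?subr_gt0 ?(le_lt_trans qN)// lerB.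
Qed.

(** One direction lets the remainder tend to 0. The other is the identity principle by hand: near 0
    the first nonzero coefficient would dominate the remainder. *)
Lemma delta_eq0 : (forall z, `|z| < 1 -> delta z = 0) <->
  forall j, c (N * j.+1)%N = c j.+1.
Proof.
have [K K0 hK] := delta_approx; split=> [d0 j|cN z z1]; last first.
  have q0 := cmod_ge0 z; have q1 : cmod z < 1 by rewrite -cmod_lt1.
  apply/eqP; rewrite -cmod_eq0 eq_le cmod_ge0 andbT; apply/ler_addgt0Pl => e e0.
  rewrite addr0.
  have cv : K * (cmod z ^+ m / (1 - cmod z)) @[m --> \oo] --> K * 0.
    by apply: cvgMr; apply: cvg_geometric_bound; rewrite q0.
  move: cv; rewrite mulr0 => /cvgrPdist_lt /(_ _ e0) [m _ /(_ m (leqnn m))].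
  rewrite /= sub0r normrN => h.
  have {hK} := hK z m z1; rewrite big1 ?mulr0 ?subr0; last first.
    by move=> i _; rewrite cN subrr mul0r mulr0.
  move=> /le_trans; apply; apply: le_trans (ltW (le_lt_trans (ler_norm _) h)).
  rewrite ler_wpM2l// ler_wpM2r ?invr_ge0 ?subr_ge0 ?(ltW q1)//.
  apply: ler_wiXn2l => //; first exact: ltW.
  by rewrite ltnW// ltnS leq_pmull.
elim/ltn_ind: j => j IH.
apply/eqP; rewrite -subr_eq0 -cmod_eq0 eq_le cmod_ge0 andbT leNgt; apply/negP => dj0.
set dj := cmod (c (N * j.+1)%N - c j.+1) in dj0.
have K1 : 0 < K * j.+1%:R + 1 by rewrite ltr_wpDl// mulr_ge0.
(* The bound [1 / 2] gives [1 / (1 - q) <= 2]. The vanishing of [delta] at [q] yields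
   [dj <= K q (j + 1)], whereas the second bound gives [K q (j + 1) + q <= dj]; hence
   [dj + q <= dj], which is absurd. *)
pose q := Num.min (1 / 2) (dj / (K * j.+1%:R + 1)).
have q0 : 0 < q by rewrite lt_min divr_gt0//= divr_gt0.
have q12 : q <= 1 / 2 by rewrite ge_min lexx.
have qd : q * (K * j.+1%:R + 1) <= dj by rewrite -ler_pdivlMr// ge_min lexx orbT.
have cq : cmod q%:C = q by rewrite cmod_real gtr0_norm.
have q1 : `|q%:C| < 1 by rewrite cmod_lt1 cq; lra.
have := hK q%:C j.+1 q1; rewrite d0// sub0r big_ord_recr /= big1 ?add0r; last first.
  by move=> i _; rewrite IH// subrr mul0r mulr0.
rewrite -mulN1r !cmodM cmodV -exprM cmodX cq -/dj exprS.
have -> : cmod (-1 : R[i]) = 1.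
  by rewrite (_ : -1 = (-1)%:C) ?cmod_real ?normrN1// rmorphN1.
have -> : cmod (2 : R[i]) = 2.
  by rewrite (_ : 2 = 2%:C) ?cmod_real ?ger0_norm// rmorph_nat.
have -> : cmod (j.+1%:R : R[i]) = j.+1%:R.
  by rewrite (_ : j.+1%:R = j.+1%:R%:C) ?cmod_real ?ger0_norm// rmorph_nat.
rewrite mul1r; set Q := q ^+ _; have Q0 : 0 < Q by exact: exprn_gt0.
have iq : (1 - q)^-1 <= 2.
  by rewrite -[leRHS]invrK lef_pV2 ?posrE ?invr_gt0//; lra.
have j0 : 0 < j.+1%:R :> R by rewrite ltr0n.
move=> h.
have : 2 * (Q * (dj / j.+1%:R)) <= K * (q * Q * 2).
  apply: le_trans h _; rewrite ler_wpM2l// ler_wpM2l//.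
  by rewrite mulr_ge0 ?ltW.
rewrite (_ : K * (q * Q * 2) = 2 * (Q * (K * q))); last by ring.
rewrite ler_pM2l// ler_pM2l// ler_pdivrMr// => h2.
have : dj + q <= dj; last by lra.
by apply: le_trans qd; rewrite mulrDr mulr1 lerD2r; lra.
Qed.

Theorem invariant_iff_herglotz_equation : power_invariant mu N <->
  forall z : R[i], `|z| < 1 ->
    herglotz_primitive mu (z ^+ N) =
    \sum_(zeta \in [set zeta : R[i] | zeta ^+ N = 1]) herglotz_primitive mu (zeta * z).
Proof.
have C0 : (0 +i* (2 * pi))^-1 != 0 :> R[i].
  by rewrite invr_eq0 eq_complex /= eqxx /= gt_eqF// pi2_gt0.
have e : power_invariant mu N <-> forall z, `|z| < 1 -> delta z = 0.
  apply: iff_trans (iff_sym delta_eq0); exact: power_invariant_fourier.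
rewrite e; split=> h z z1.
  rewrite sum_complex_roots// -mulr_sumr; congr (_ * _); apply/esym/eqP.
  by rewrite -subr_eq0; apply/eqP; exact: h.
have := h z z1; rewrite sum_complex_roots// -mulr_sumr => /(mulfI C0) hz.
by rewrite /delta /J /herglotz_segment hz subrr.
Qed.

End herglotz_equation.

(** In (a) the second clause quantifies over every [c0], so any constant satisfying the equation
    almost everywhere has the stated value; existence is in the first clause. *)
Theorem proposition11 (R : realType) (N : nat) (N_ge1 : (1 <= N)%N)
    (mu : {charge set (circle R) -> \bar R}) :
  (* (a) *)
  (power_invariant mu N <->
     exists c0 : R, {ae haar, forall eta : circle R,
       cmf mu (eta ^+ N)%g =
       \sum_(zeta \in [set zeta : circle R | (zeta ^+ N)%g = 1%g])
         cmf mu (zeta * eta)%g - c0}) /\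
  (power_invariant mu N ->
     forall c0 : R, {ae haar, forall eta : circle R,
       cmf mu (eta ^+ N)%g =
       \sum_(zeta \in [set zeta : circle R | (zeta ^+ N)%g = 1%g])
         cmf mu (zeta * eta)%g - c0} ->
     (forall eta : circle R,
       cmf mu (eta ^+ N)%g =
       \sum_(zeta \in [set zeta : circle R | (zeta ^+ N)%g = 1%g])
         cmf mu (zeta * eta)%g - c0) /\
     c0 = \sum_(zeta \in [set zeta : circle R | (zeta ^+ N)%g = 1%g])
            cmf mu zeta /\
     c0 = (N%:R - 1) * cmf_mean mu) /\
  (* (b) *)
  (power_invariant mu N <->
     forall z : R[i], `|z| < 1 ->
       herglotz_primitive mu (z ^+ N) =
       \sum_(zeta \in [set zeta : R[i] | zeta ^+ N = 1])
         herglotz_primitive mu (zeta * z)).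
Proof.
have [a1 a2] := invariant_iff_cmf_equation N_ge1 mu.
by split=> //; split=> //; exact: invariant_iff_herglotz_equation.
Qed.
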